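(* Let $f$ be a weakly biased random multiplicative function. If almost surely $M_f(x)=o(x^{1-\delta})$ for some (possibly random) $0<\delta<1/2$, then there exists $0<\alpha<1/2$ such that the random series $\sum_{p\in\mathcal{P}}\frac{f(p)}{p^{1-\alpha}}$ converges almost surely.
   Context: $\mathcal{P}$ denotes the set of primes and $\mu$ the Möbius function. A random multiplicative function is a random function $f:\mathbb{N}\times\Omega\to\{-1,0,1\}$ with $f(1)=1$, $f(n)=|\mu(n)|\prod_{p\mid n}f(p)$ for $n\ge2$, where $\{f(p)\}_{p\in\mathcal{P}}$ are independent $\pm1$-valued random variables. $f$ is biased if $\mathbb{E} f(p)<0$ for all primes $p$; it is weakly biased if it is biased and $\sum_{p\in\mathcal{P}} f(p)/p$ converges almost surely. $M_f(x):=\sum_{n\le x}f(n)$. *)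

(* Defs.v *)
From HB Require Import structures.
From mathcomp Require Import all_boot all_order all_algebra.
From mathcomp Require Import finmap.
From mathcomp Require Import all_classical all_reals all_analysis.

Set Implicit Arguments.
Unset Strict Implicit.
Unset Printing Implicit Defensive.

Import Order.TTheory GRing.Theory Num.Theory.
Import numFieldNormedType.Exports.

Local Open Scope classical_set_scope.
Local Open Scope ring_scope.

(* Lets the Landau notation =o_F be used with the filter +oo. *)
Canonical pinfty_filter_on (R : numFieldType) : filter_on R :=
  FilterType (pinfty_nbhs R) _.

Definition squarefree (n : nat) : bool :=
  (0 < n)%N && all (fun p => logn p n == 1%N) (primes n).

Definition moebius (n : nat) : int :=
  if squarefree n then (-1) ^+ size (primes n) else 0.

Definition mutually_independent (d : measure_display) (T : measurableType d)
    (R : realType) (P : probability T R) (I : choiceType) (A : set I)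
    (X : I -> {RV P >-> R}) : Prop :=
  forall (J : {fset I}) (B : I -> set R),
    [set` J] `<=` A ->
    (forall i, i \in J -> measurable (B i)) ->
    P (\bigcap_(i in [set` J]) (X i @^-1` B i))
    = (\prod_(i <- J) P (X i @^-1` B i))%E.

(* The positive integers are the intended domain: f 0 is an unconstrained dummy
   value, used nowhere below. *)
Record random_multiplicative (d : measure_display) (T : measurableType d)
    (R : realType) (P : probability T R) (f : nat -> {RV P >-> R}) : Prop := {
  rm_range : forall (n : nat) (w : T),
    (0 < n)%N -> [\/ f n w = -1, f n w = 0 | f n w = 1];
  rm_1 : forall w : T, f 1%N w = 1;
  rm_mult : forall (n : nat) (w : T), (2 <= n)%N ->
    f n w = `|moebius n|%:~R * \prod_(p <- primes n) f p w;
  rm_prime : forall (p : nat) (w : T), prime p -> f p w = -1 \/ f p w = 1;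
  rm_indep : mutually_independent [set p : nat | prime p] f
}.

Definition biased (d : measure_display) (T : measurableType d)
    (R : realType) (P : probability T R) (f : nat -> {RV P >-> R}) : Prop :=
  forall p : nat, prime p -> ('E_P[f p] < 0)%E.

(* Convergence of the partial sums \sum_(p < N, p prime) u p, i.e. of the series
   over the primes taken in increasing order; not absolute convergence. *)
Definition prime_series_cvg (R : realType) (u : nat -> R) : Prop :=
  cvgn (series (fun n : nat => if prime n then u n else 0)).

Definition weakly_biased (d : measure_display) (T : measurableType d)
    (R : realType) (P : probability T R) (f : nat -> {RV P >-> R}) : Prop :=
  biased f /\
  {ae P, forall w, prime_series_cvg (fun p : nat => f p w / p%:R)}.

Definition partial_sum (d : measure_display) (T : measurableType d)
    (R : realType) (P : probability T R) (f : nat -> {RV P >-> R})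
    (w : T) (x : R) : R :=
  \sum_(1 <= n < (Num.truncn x).+1) f n w.

(* Main.v *)
Require Import Defs.
From mathcomp Require Import all_boot all_order all_algebra.
From mathcomp Require Import finmap.
From mathcomp Require Import all_classical all_reals all_analysis.
From mathcomp Require Import measurable_realfun ring lra zify.
Import Order.TTheory GRing.Theory Num.Theory.
Import numFieldNormedType.Exports.
Local Open Scope classical_set_scope.
Local Open Scope ring_scope.

Set Implicit Arguments.
Unset Strict Implicit.
Unset Printing Implicit Defensive.

(* Write [e p = E f(p) <= 0].  The [f p - e p] are bounded and uncorrelated, so
   Chebyshev's inequality along fourth powers gives, almost surely,
   [sum_(p <= n) (f p - e p) = O(n ^ (3/4))], and by partial summation
   [sum (f p - e p) p ^ (- s)] converges for [s > 3/4].  It remains to find one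
   [s < 1] at which the deterministic series [sum e p p ^ (- s)] converges, and
   for this a single sample point is enough.

   There the hypothesis on the partial sums makes [F(s) = sum f(n) n ^ (- s)]
   analytic around [s = 1], while the convergence of [sum f(p) / p] and the Euler
   product bound [F(a)] away from [0] as [a] decreases to [1].  With
   [P(s) = sum f(p) p ^ (- s)], the difference [P' - F' / F] only involves the
   squares of primes and is analytic for [s > 1/2]; so [P], and with it
   [sum e p p ^ (- s)], is analytic around [1].  The coefficients [e p] have
   constant sign, and Landau's theorem pushes the convergence to the left of [1].
   Everything is done with real [a > 1]: analyticity is encoded by bounds on the
   Taylor coefficients at [a] in the submultiplicative norm [sum |u k| r ^ k],
   uniform in [a], so no complex variable is needed. *)

Section WeightedNorm.
Variable R : realType.
Implicit Types (r s c : R) (u v : nat -> R).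

Definition wnorm r (K : nat) u : R := \sum_(k < K) `|u k| * r ^+ k.

Definition cauchy_prod u v : nat -> R :=
  fun k => \sum_(j < k.+1) u j * v (k - j)%N.

Definition formal_deriv u : nat -> R := fun k => k.+1%:R * u k.+1.

Lemma wnorm_ge0 r K u : 0 <= r -> 0 <= wnorm r K u.
Proof. by move=> r0; apply: sumr_ge0 => k _; rewrite mulr_ge0 ?exprn_ge0. Qed.

Lemma eq_wnorm r K u v : u =1 v -> wnorm r K u = wnorm r K v.
Proof. by move=> uv; apply: eq_bigr => k _; rewrite uv. Qed.

Lemma le_wnorm r s K u : 0 <= r <= s -> wnorm r K u <= wnorm s K u.
Proof.
move=> /andP[r0 rs]; apply: ler_sum => k _; rewrite ler_wpM2l//.
by rewrite lerXn2r ?nnegrE// (le_trans r0).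
Qed.

Lemma wnormD r K u v : 0 <= r ->
  wnorm r K (fun k => u k + v k) <= wnorm r K u + wnorm r K v.
Proof.
move=> r0; rewrite -big_split/=; apply: ler_sum => k _.
by rewrite -mulrDl ler_wpM2r ?exprn_ge0 ?ler_normD.
Qed.

Lemma wnormN r K u : wnorm r K (fun k => - u k) = wnorm r K u.
Proof. by apply: eq_bigr => k _; rewrite normrN. Qed.

Lemma wnormB r K u v : 0 <= r ->
  wnorm r K (fun k => u k - v k) <= wnorm r K u + wnorm r K v.
Proof. by move=> r0; rewrite -(wnormN _ _ v); exact: wnormD. Qed.

Lemma wnormZ r K u c : wnorm r K (fun k => c * u k) = `|c| * wnorm r K u.
Proof. by rewrite mulr_sumr; apply: eq_bigr => k _; rewrite normrM mulrA. Qed.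

Lemma wnorm_sum r K (I : Type) (s : seq I) (Q : pred I) (w : I -> nat -> R) :
  0 <= r ->
  wnorm r K (fun k => \sum_(i <- s | Q i) w i k)
    <= \sum_(i <- s | Q i) wnorm r K (w i).
Proof.
move=> r0; rewrite exchange_big/=; apply: ler_sum => k _.
by rewrite -mulr_suml ler_wpM2r ?exprn_ge0 ?ler_norm_sum.
Qed.

Lemma cvg_sumr (I : Type) (s : seq I) (h : I -> nat -> R) (l : I -> R) :
  (forall i, h i @ \oo --> l i) ->
  (fun n => \sum_(i <- s) h i n) @ \oo --> \sum_(i <- s) l i.
Proof. by move=> hl; apply: (cvg_big add_continuous). Qed.

Lemma cvg_wnorm r K (u : nat -> nat -> R) v :
  (forall k, u ^~ k @ \oo --> v k) ->
  (fun X => wnorm r K (u X)) @ \oo --> wnorm r K v.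
Proof.
move=> uv; apply: (@cvg_sumr _ _ (fun (k : 'I_K) X => `|u X k| * r ^+ k)) => k.
by apply: cvgM; [apply: cvg_norm|exact: cvg_cst].
Qed.

Lemma wnorm_lim_le r K (u : nat -> nat -> R) v c :
  (forall X, wnorm r K (u X) <= c) -> (forall k, u ^~ k @ \oo --> v k) ->
  wnorm r K v <= c.
Proof.
by move=> uc uv; apply: (cvgr_to_le (cvg_wnorm (r := r) (K := K) uv)); near=> X.
Unshelve. all: by end_near. Qed.

Lemma cvg_cauchy_prodl (u : nat -> nat -> R) v w k :
  (forall i, u ^~ i @ \oo --> v i) ->
  (fun X => cauchy_prod (u X) w k) @ \oo --> cauchy_prod v w k.
Proof.
move=> uv.
apply: (@cvg_sumr _ _ (fun (j : 'I_k.+1) X => u X j * w (k - j)%N)) => j.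
by apply: cvgM => //; exact: cvg_cst.
Qed.

Lemma cvg_cauchy_prodr (u : nat -> nat -> R) v w k :
  (forall i, u ^~ i @ \oo --> v i) ->
  (fun X => cauchy_prod w (u X) k) @ \oo --> cauchy_prod w v k.
Proof.
move=> uv.
apply: (@cvg_sumr _ _ (fun (j : 'I_k.+1) X => w j * u X (k - j)%N)) => j.
by apply: cvgM => //; exact: cvg_cst.
Qed.

Lemma sum_cauchy_prod_le K u v : (forall k, 0 <= u k) -> (forall k, 0 <= v k) ->
  \sum_(k < K) cauchy_prod u v k <= (\sum_(k < K) u k) * (\sum_(k < K) v k).
Proof.
move=> u0 v0.
have shift_sum j : (j < K)%N ->
    \sum_(0 <= k < K | (j < k.+1)%N) v (k - j)%N = \sum_(0 <= i < K - j) v i.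
  move=> jK; rewrite (big_cat_nat (n := j)) ?(ltnW jK)//=.
  rewrite big_nat_cond big_pred0 ?add0r; last by move=> k; lia.
  rewrite -{1}(add0n j) big_addn; under eq_bigr do rewrite addnK.
  by apply: eq_bigl => k; rewrite ltnS leq_addl.
have -> : \sum_(k < K) cauchy_prod u v k =
    \sum_(0 <= k < K) \sum_(0 <= j < K | (j < k.+1)%N) u j * v (k - j)%N.
  rewrite big_mkord; apply: eq_bigr => k _.
  by rewrite -(big_nat_widen _ _ _ xpredT) ?ltn_ord// big_mkord.
rewrite -2!(big_mkord xpredT) (exchange_big_dep_nat xpredT)//= mulr_suml.
rewrite big_nat [leRHS]big_nat; apply: ler_sum => j /andP[_ jK].
rewrite -mulr_sumr ler_wpM2l// shift_sum//.
rewrite [leRHS](big_cat_nat (n := (K - j)%N)) ?leq_subr//=.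
by rewrite lerDl sumr_ge0.
Qed.

Lemma wnorm_cauchy_prod r K u v : 0 <= r ->
  wnorm r K (cauchy_prod u v) <= wnorm r K u * wnorm r K v.
Proof.
move=> r0; pose weigh (w : nat -> R) k := `|w k| * r ^+ k.
have weigh_ge0 w k : 0 <= weigh w k by rewrite mulr_ge0 ?exprn_ge0.
apply: le_trans (sum_cauchy_prod_le K (weigh_ge0 u) (weigh_ge0 v)).
apply: ler_sum => k _.
rewrite (le_trans (ler_wpM2r _ (ler_norm_sum _ _ _))) ?exprn_ge0// mulr_suml.
apply: ler_sum => j _; rewrite normrM mulrACA -exprD subnKC//.
by rewrite -ltnS.
Qed.

Lemma wnorm_tail r s K u : 0 <= r -> r <= s -> 0 < s ->
  wnorm r K u - `|u 0%N| <= r / s * wnorm s K u.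
Proof.
move=> r0 rs s0; case: K => [|K].
  by rewrite /wnorm !big_ord0 mulr0 sub0r oppr_le0.
rewrite /wnorm !big_ord_recl/= !expr0 !mulr1 addrAC subrr add0r mulrDr.
rewrite -[leLHS]add0r; apply: lerD; first by rewrite mulr_ge0 ?divr_ge0 ?(ltW s0).
rewrite mulr_sumr; apply: ler_sum => k _.
rewrite mulrCA ler_wpM2l// /bump/= add1n !exprS mulrA divfK ?gt_eqF//.
by rewrite ler_wpM2l// lerXn2r ?nnegrE// ltW.
Qed.

(* Multiplication by [v] is inverted as soon as the constant term of [v] dominates
   the rest of [v]. *)
Lemma wnorm_cauchy_prod_div r K u v c : 0 <= r -> 0 < c -> c <= `|v 0%N| ->
  wnorm r K v - `|v 0%N| <= c / 2 ->
  wnorm r K u <= 2 / c * wnorm r K (cauchy_prod u v).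
Proof.
move=> r0 c0 cv v_tail.
case: K v_tail => [|K] v_tail; first by rewrite /wnorm !big_ord0 mulr0.
pose v' k := if k == 0%N then 0 else v k.
have v0uE k : v 0%N * u k = cauchy_prod u v k - cauchy_prod u v' k.
  rewrite /cauchy_prod -sumrB big_ord_recr/= subnn /v' eqxx mulr0 subr0 mulrC.
  rewrite big1 ?add0r// => j _; case: ifPn => [|_]; last by rewrite subrr.
  by rewrite subn_eq0 leqNgt ltn_ord.
have v'E : wnorm r K.+1 v' = wnorm r K.+1 v - `|v 0%N|.
  rewrite /wnorm !big_ord_recl/= !expr0 !mulr1 addrAC subrr add0r.
  by rewrite /v' eqxx normr0 add0r.
have : `|v 0%N| * wnorm r K.+1 u <=
    wnorm r K.+1 (cauchy_prod u v) + wnorm r K.+1 u * (c / 2).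
  rewrite -wnormZ (eq_wnorm _ _ v0uE) (le_trans (wnormB _ _ _ r0))//.
  rewrite lerD2l (le_trans (wnorm_cauchy_prod _ _ _ r0))//.
  by rewrite v'E ler_wpM2l ?wnorm_ge0.
move/(le_trans (ler_wpM2r (wnorm_ge0 K.+1 u r0) cv)).
rewrite mulrAC ler_pdivlMr//.
by move: (wnorm r K.+1 u) (wnorm _ _ (cauchy_prod _ _)) => *; lra.
Qed.

(* Since [k + 1 <= 2 ^ (k + 1)], formal differentiation costs a factor [2] in
   the radius. *)
Lemma wnorm_formal_deriv r K u : 0 < r ->
  wnorm r K (formal_deriv u) <= wnorm (2 * r) K.+1 u / r.
Proof.
move=> r0; rewrite ler_pdivlMr// /wnorm big_ord_recl/=.
rewrite -[leLHS]add0r; apply: lerD; first by rewrite mulr1.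
rewrite mulr_suml; apply: ler_sum => k _.
rewrite normrM (ger0_norm (ler0n _ _)) /bump/= add1n exprMn.
rewrite [leLHS](_ : _ = k.+1%:R * (`|u k.+1| * r ^+ k.+1)); last first.
  by rewrite exprS; ring.
rewrite [leRHS](_ : _ = 2 ^+ k.+1 * (`|u k.+1| * r ^+ k.+1)); last by ring.
rewrite ler_wpM2r ?mulr_ge0 ?exprn_ge0 ?(ltW r0)//.
by rewrite -natrX ler_nat ltnW// ltn_expl.
Qed.

Lemma wnorm_le_formal_deriv r K u : 0 <= r ->
  wnorm r K u <= `|u 0%N| + r * wnorm r K (formal_deriv u).
Proof.
move=> r0; case: K => [|K].
  by rewrite /wnorm !big_ord0 mulr0 addr0.
rewrite {1}/wnorm big_ord_recl expr0 mulr1 lerD2l.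
rewrite [in leRHS]/wnorm big_ord_recr/= mulrDr -[leLHS]addr0.
apply: lerD; last by rewrite !mulr_ge0 ?exprn_ge0.
rewrite mulr_sumr; apply: ler_sum => k _; rewrite /bump/= add1n exprS.
rewrite [leRHS]mulrCA ler_wpM2r ?mulr_ge0 ?exprn_ge0//.
by rewrite normrM ler_peMl// normr_nat ler1n.
Qed.

End WeightedNorm.

Section ExponentialCoefficients.
Variable R : realType.
Implicit Types (r x y : R).

Lemma exp_coeffD x y :
  exp_coeff (x + y) =1 cauchy_prod (exp_coeff x) (exp_coeff y).
Proof.
move=> k; rewrite /exp_coeff/cauchy_prod/= addrC exprDn mulr_suml.
apply: eq_bigr => -[j /=]; rewrite ltnS => jk _.
rewrite -mulr_natr -(bin_fact jk) !natrM.
have fact_neq0 i : (i`!%:R : R) != 0 by rewrite pnatr_eq0 -lt0n fact_gt0.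
have bin_neq0 : ('C(k, j)%:R : R) != 0 by rewrite pnatr_eq0 -lt0n bin_gt0.
by field; rewrite !fact_neq0 bin_neq0.
Qed.

Lemma formal_deriv_exp_coeff x k : formal_deriv (exp_coeff x) k = x * exp_coeff x k.
Proof.
rewrite /formal_deriv /exp_coeff/= factS natrM exprS.
have k0 : (k`!%:R : R) != 0 by rewrite pnatr_eq0 -lt0n fact_gt0.
have k1 : (k.+1%:R : R) != 0 by rewrite pnatr_eq0.
by field; rewrite k0 nat1r k1.
Qed.

Lemma series_exp_coeff_le x K : 0 <= x -> series (exp_coeff x) K <= expR x.
Proof.
move=> x0; apply: nondecreasing_cvgn_le; last exact: is_cvg_series_exp_coeff.
by apply: nondecreasing_series => k _ _; exact: exp_coeff_ge0.
Qed.

Lemma wnorm_exp_coeffE r x K : 0 <= x ->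
  wnorm r K (exp_coeff x) = series (exp_coeff (r * x)) K.
Proof.
move=> x0; rewrite /series/= big_mkord; apply: eq_bigr => k _.
by rewrite ger0_norm ?exp_coeff_ge0// /exp_coeff/= exprMn; ring.
Qed.

Lemma wnorm_exp_coeff r x K : 0 <= r -> 0 <= x ->
  wnorm r K (exp_coeff x) <= expR (r * x).
Proof.
by move=> r0 x0; rewrite wnorm_exp_coeffE// series_exp_coeff_le// mulr_ge0.
Qed.

Lemma exp_coeff_le x y k : 0 <= x <= y -> exp_coeff x k <= exp_coeff y k.
Proof.
move=> /andP[x0 xy]; rewrite /exp_coeff/= ler_wpM2r ?invr_ge0//.
by rewrite lerXn2r ?nnegrE// (le_trans x0).
Qed.

Lemma wnorm_exp_coeffB r x y K : 0 <= r -> 0 <= x <= y ->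
  wnorm r K (fun k => exp_coeff y k - exp_coeff x k)
    <= expR (r * y) - expR (r * x).
Proof.
move=> r0 xy; have /andP[x0 x_le_y] := xy.
have rxy : 0 <= r * x <= r * y by rewrite mulr_ge0//= ler_wpM2l.
pose diff_coeff k := exp_coeff (r * y) k - exp_coeff (r * x) k.
have cvg_diff : series diff_coeff @ \oo --> expR (r * y) - expR (r * x).
  rewrite (_ : series _ = series (exp_coeff (r * y)) - series (exp_coeff (r * x))).
    by apply: cvgB; exact: is_cvg_series_exp_coeff.
  by apply/funext => n; rewrite /series/= sumrB.
have -> : wnorm r K (fun k => exp_coeff y k - exp_coeff x k) = series diff_coeff K.
  rewrite /series/= big_mkord; apply: eq_bigr => k _.
  rewrite ger0_norm ?subr_ge0 ?exp_coeff_le//.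
  by rewrite /diff_coeff /exp_coeff/= mulrBl !exprMn; congr (_ - _); ring.
rewrite -(cvg_lim _ cvg_diff)//; apply: nondecreasing_cvgn_le.
  by apply: nondecreasing_series => k _ _; rewrite subr_ge0 exp_coeff_le.
by apply/cvg_ex; exists (expR (r * y) - expR (r * x)).
Qed.

End ExponentialCoefficients.

Section RealPowers.
Variable R : realType.
Implicit Types (x s t : R) (n : nat).

Lemma powR_natE n s : (0 < n)%N -> n%:R `^ s = expR (s * ln n%:R) :> R.
Proof. by move=> n0; rewrite /powR pnatr_eq0 gtn_eqF. Qed.

Lemma powR_natD n s t : (0 < n)%N -> n%:R `^ (s + t) = n%:R `^ s * n%:R `^ t :> R.
Proof. by move=> n0; rewrite powRD// pnatr_eq0 -lt0n n0 implybT. Qed.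

Lemma ler_powR_nat n s t : (0 < n)%N -> s <= t -> n%:R `^ s <= n%:R `^ t :> R.
Proof. by move=> n0; apply: ler_powR; rewrite ler1n. Qed.

Lemma powR_nat_le1 n s : (0 < n)%N -> s <= 0 -> n%:R `^ s <= 1 :> R.
Proof. by move=> n0 s0; rewrite -[leRHS](powRr0 n%:R) ler_powR_nat. Qed.

Lemma powRN_nat_le n s t : (1 < n)%N -> 0 <= s -> t <= - s ->
  n%:R `^ t <= 2 `^ (- s) :> R.
Proof.
move=> n1 s0 ts; have n0 := ltnW n1.
apply: le_trans (ler_powR_nat n0 ts) _.
by rewrite !powRN lef_pV2 ?posrE ?powR_gt0 ?ltr0n// ge0_ler_powR ?nnegrE ?ler_nat.
Qed.

Lemma powR2N_le s : 2^-1 <= s -> 2 `^ (- s) <= 3 / 4 :> R.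
Proof.
move=> s2; apply: (@le_trans _ _ (2 `^ (- 2^-1))).
  by apply: (@ler_powR_nat 2) => //; rewrite lerN2.
have : 2 `^ (- 2^-1) * 2 `^ (- 2^-1) = 2^-1 :> R.
  rewrite -(@powR_natD 2)// (_ : - 2^-1 - 2^-1 = - 1 :> R) ?powR_inv1//; lra.
have : 0 <= 2 `^ (- 2^-1) :> R by exact: powR_ge0.
nra.
Qed.

Lemma ln_nat_ge0 n : 0 <= ln n%:R :> R.
Proof. by case: n => [|n]; [rewrite ln0|rewrite ln_ge0// ler1n]. Qed.

Lemma ler_ln_nat m n : (0 < m)%N -> (m <= n)%N -> ln m%:R <= ln n%:R :> R.
Proof.
by move=> m0 mn; rewrite ler_ln ?posrE ?ltr0n ?ler_nat// (leq_trans m0).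
Qed.

Lemma ln_le_powR x t : 0 < x -> 0 < t -> ln x <= x `^ t / t.
Proof.
move=> x0 t0; rewrite ler_pdivlMr// mulrC -ln_powR.
exact/ltW/ln_sublinear/powR_gt0.
Qed.

Lemma ln_succ_sub_le n : (0 < n)%N -> ln n.+1%:R - ln n%:R <= n%:R^-1 :> R.
Proof.
move=> n0; have n_gt0 : (0 : R) < n%:R by rewrite ltr0n.
rewrite -ln_div ?posrE ?ltr0n// -natr1 mulrDl divff ?gt_eqF// mul1r.
by apply: le_ln1Dx; rewrite (lt_trans (ltrN10 _))// invr_gt0.
Qed.

Lemma ln_succ_sub_ge n : (0 < n)%N -> n.+1%:R^-1 <= ln n.+1%:R - ln n%:R :> R.
Proof.
move=> n0; rewrite -[leRHS]opprB lerNr -ln_div ?posrE ?ltr0n//.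
rewrite (_ : n%:R / n.+1%:R = 1 + - n.+1%:R^-1 :> R); last by field.
by apply: le_ln1Dx; rewrite ltrN2 invf_lt1 ?ltr0n// ltr1n.
Qed.

Lemma powR_succ_le n s : (0 < n)%N -> 0 <= s <= 1 ->
  n.+1%:R `^ s <= n%:R `^ s * (1 + n%:R^-1) :> R.
Proof.
move=> n0 /andP[s0 s1].
have n_neq0 : n%:R != 0 :> R by rewrite pnatr_eq0 -lt0n.
rewrite (_ : n.+1%:R = n%:R * (1 + n%:R^-1)); last first.
  by rewrite mulrDr mulr1 divff// natr1.
by rewrite powRM ?addr_ge0// ler_wpM2l ?powR_ge0// ler1_powR// lerDl.
Qed.

Lemma powR_succ_le2 n s : (0 < n)%N -> 0 <= s <= 1 ->
  n.+1%:R `^ s <= 2 * n%:R `^ s :> R.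
Proof.
move=> n0 s01; apply: le_trans (powR_succ_le n0 s01) _.
rewrite mulrC ler_wpM2r ?powR_ge0//.
have : n%:R^-1 <= 1 :> R by rewrite invf_le1 ?ltr0n ?ler1n.
by move: (n%:R^-1) => y; lra.
Qed.

Lemma powRN_succ_le n s : (0 < n)%N -> 0 <= s -> n.+1%:R `^ (- s) <= n%:R `^ (- s) :> R.
Proof.
move=> n0 s0; rewrite !powR_natE// ler_expR !mulNr lerN2.
by rewrite ler_wpM2l// ler_ln_nat.
Qed.

Lemma powRN_sub_succ_le n s : (0 < n)%N -> 0 <= s ->
  n%:R `^ (- s) - n.+1%:R `^ (- s) <= s * n%:R `^ (- s - 1) :> R.
Proof.
move=> n0 s0; rewrite powR_natD// powR_inv1// lerBlDr -lerBlDl !powR_natE//.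
rewrite [leLHS](_ : _ = expR (- s * ln n%:R) * (1 - s * n%:R^-1)); last by ring.
have -> : - s * ln n.+1%:R = - s * ln n%:R + - s * (ln n.+1%:R - ln n%:R) by ring.
rewrite expRD ler_wpM2l ?expR_ge0// (le_trans _ (expR_ge1Dx _))//.
by rewrite mulNr lerD2l lerN2 ler_wpM2l// ln_succ_sub_le.
Qed.

Lemma powRN_sub_succ_ge n t : (0 < n)%N -> 0 <= t ->
  t * n.+1%:R `^ (- 1 - t) <= n%:R `^ (- t) - n.+1%:R `^ (- t) :> R.
Proof.
move=> n0 t0; rewrite [- 1 - t]addrC powR_natD// powR_inv1// lerBrDr.
rewrite [leLHS](_ : _ = n.+1%:R `^ (- t) * (1 + t * n.+1%:R^-1)); last by ring.
rewrite !powR_natE//.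
have -> : - t * ln n%:R = - t * ln n.+1%:R + t * (ln n.+1%:R - ln n%:R) by ring.
rewrite expRD ler_wpM2l ?expR_ge0// (le_trans _ (expR_ge1Dx _))//.
by rewrite lerD2l ler_wpM2l ?ln_succ_sub_ge.
Qed.

Lemma series_powR_le t N : 0 < t ->
  series (fun n => n%:R `^ (- 1 - t)) N <= 1 + t^-1 :> R.
Proof.
move=> t0; have tinv_ge0 : 0 <= t^-1 by rewrite invr_ge0 ltW.
have pow0 : (0%:R : R) `^ (- 1 - t) = 0 by rewrite powR0// lt_eqF//; lra.
suff telescoped n :
    series (fun n => n%:R `^ (- 1 - t)) n.+2 <= 1 + t^-1 - n.+1%:R `^ (- t) / t :> R.
  case: N => [|[|N]].
  - by rewrite /series/= big_geq//; lra.
  - by rewrite /series/= big_nat1 pow0; lra.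
  - by rewrite (le_trans (telescoped N))// lerBlDr lerDl divr_ge0 ?powR_ge0 ?ltW.
elim: n => [|n IH].
  by rewrite /series/= !big_nat_recr//= big_geq// pow0 !powR1 mul1r addrK !add0r.
rewrite seriesSr (le_trans (lerD IH (lexx _)))//.
suff : n.+2%:R `^ (- 1 - t) <= (n.+1%:R `^ (- t) - n.+2%:R `^ (- t)) / t :> R.
  by rewrite mulrBl; move: (_ / t) (_ / t) => *; lra.
by rewrite ler_pdivlMr// mulrC powRN_sub_succ_ge// ltW.
Qed.

Lemma is_cvg_series_powR t : 0 < t -> cvgn (series (fun n => n%:R `^ (- 1 - t) : R)).
Proof.
move=> t0; apply: nondecreasing_is_cvgn.
  by apply: nondecreasing_series => n _ _; exact: powR_ge0.
by exists (1 + t^-1) => _ [n _ <-]; exact: series_powR_le.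
Qed.

Lemma cvg_powRN t : 0 < t -> (fun n => n%:R `^ (- t) : R) @ \oo --> 0.
Proof.
move=> t0; apply/cvgrPdist_lt => e e0; near=> n.
have n0 : (0 < n)%N by near: n; exact: nbhs_infty_gt.
rewrite sub0r normrN ger0_norm ?powR_ge0//.
rewrite powRN invf_plt ?posrE ?powR_gt0 ?ltr0n//.
have -> : e^-1 = (e^-1 `^ t^-1) `^ t.
  by rewrite -powRrM mulVf ?gt_eqF// powRr1// invr_ge0 ltW.
rewrite gt0_ltr_powR ?nnegrE ?powR_ge0//.
by near: n; exact: nbhs_infty_gtr.
Unshelve. all: by end_near. Qed.

Lemma expR_le1Dx x : `|x| <= 2^-1 -> expR (x - 2 * (x * x)) <= 1 + x.
Proof.
rewrite ler_norml => /andP[x_ge x_le].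
have x1_gt0 : 0 < 1 + x by lra.
have x1_neq0 : 1 + x != 0 by rewrite gt_eqF.
suff : expR (x / (1 + x)) <= 1 + x.
  by apply: le_trans; rewrite ler_expR ler_pdivlMr//; nra.
rewrite -[leRHS]invrK -[leLHS]invrK -expRN lef_pV2 ?posrE ?expR_gt0 ?invr_gt0//.
rewrite (le_trans _ (expR_ge1Dx _))// [leRHS](_ : _ = (1 + x)^-1)//.
by field.
Qed.

Lemma expR_le_prod_1D (I : Type) (s : seq I) (Q : pred I) (y : I -> R) :
  (forall i, Q i -> `|y i| <= 2^-1) ->
  expR (\sum_(i <- s | Q i) y i - 2 * \sum_(i <- s | Q i) (y i * y i))
    <= \prod_(i <- s | Q i) (1 + y i).
Proof.
move=> y_le; rewrite mulr_sumr -sumrB expR_sum.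
by apply: ler_prod => i Qi; rewrite expR_ge0 expR_le1Dx ?y_le.
Qed.

End RealPowers.

Section SummationByParts.
Variable R : realType.
Implicit Types (s t C : R) (u b : nat -> R).

Definition sums_le_powR C s u : Prop :=
  forall n, `|series u n.+1| <= C * n%:R `^ s.

Lemma sums_le_powR_ge0 C s u : sums_le_powR C s u -> 0 <= C.
Proof. by move=> /(_ 1%N); rewrite powR1 mulr1; exact: le_trans. Qed.

Lemma sums_le_powR_at0 C s u : s != 0 -> sums_le_powR C s u -> series u 1 = 0.
Proof.
by move=> s0 /(_ 0%N); rewrite powR0// mulr0 normr_le0 => /eqP.
Qed.

Lemma sums_le_powR_le C s t u : s != 0 -> s <= t -> sums_le_powR C s u ->
  sums_le_powR C t u.
Proof.
move=> s0 st uC n; apply: le_trans (uC n) _.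
rewrite ler_wpM2l ?(sums_le_powR_ge0 uC)//.
by case: n => [|n]; [rewrite powR0 ?powR_ge0|rewrite ler_powR_nat].
Qed.

Lemma abel_summation u b (X : nat) :
  series (fun n => u n * b n) X =
  series u X * b X + series (fun n => series u n.+1 * (b n - b n.+1)) X.
Proof.
elim: X => [|X IH]; first by rewrite /series/= !big_geq// mul0r addr0.
by rewrite seriesSr IH [X in _ = _ + X]seriesSr (seriesSr u); ring.
Qed.

Lemma cvg_sums_le_powR_boundary C s t u : 0 <= t < s -> sums_le_powR C t u ->
  (fun X => series u X * X%:R `^ (- s)) @ \oo --> 0.
Proof.
move=> /andP[t0 ts] uC; have C0 := sums_le_powR_ge0 uC.
rewrite -(@cvg_shiftS R).
have cvg_bound c : (fun n => c * n.+1%:R `^ (- (s - t))) @ \oo --> (0 : R).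
  rewrite -(mulr0 c); apply: cvgM; first exact: cvg_cst.
  rewrite (@cvg_shiftS R (fun n => n%:R `^ _)); apply: cvg_powRN.
  by rewrite subr_gt0.
apply: (squeeze_cvgr _ (cvg_bound (- C)) (cvg_bound C)); near=> n.
rewrite mulNr -ler_norml normrM (ger0_norm (powR_ge0 _ _)).
rewrite opprB powR_natD// mulrA ler_wpM2r ?powR_ge0// (le_trans (uC n))//.
by rewrite ler_wpM2l// ge0_ler_powR// ?nnegrE// ler_nat.
Unshelve. all: by end_near. Qed.

Lemma is_cvg_series_sums_le_powR C s t u : 0 < t < s -> sums_le_powR C t u ->
  cvgn (series (fun n => u n * n%:R `^ (- s))).
Proof.
move=> /andP[t0 ts] uC; have C0 := sums_le_powR_ge0 uC.
have s0 : 0 < s by exact: lt_trans ts.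
rewrite (_ : series _ = (fun X => series u X * X%:R `^ (- s)) +
  series (fun n => series u n.+1 * (n%:R `^ (- s) - n.+1%:R `^ (- s)))); last first.
  by apply/funext => X; rewrite abel_summation.
apply: is_cvgD.
  apply/cvg_ex; exists 0; apply: cvg_sums_le_powR_boundary uC.
  by rewrite (ltW t0).
apply: normed_cvg.
pose majorant n : R := (C * s) * n%:R `^ (- 1 - (s - t)).
apply: (@series_le_cvg _ _ majorant) => [n|n|[|n]|] /=.
- exact: normr_ge0.
- by rewrite !mulr_ge0 ?powR_ge0// ltW.
- rewrite /= (sums_le_powR_at0 _ uC) ?gt_eqF// mul0r normr0.
  by rewrite !mulr_ge0 ?powR_ge0// ltW.
- rewrite /= normrM.
  apply: (@le_trans _ _ (C * n.+1%:R `^ t * (s * n.+1%:R `^ (- s - 1)))).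
    rewrite ler_pM ?uC// ger0_norm ?subr_ge0 ?powRN_succ_le ?(ltW s0)//.
    by rewrite powRN_sub_succ_le// ltW.
  rewrite mulrACA -powR_natD// ler_wpM2l ?mulr_ge0 ?(ltW s0)// ler_powR_nat//; lra.
- by apply: is_cvg_seriesZ; apply: is_cvg_series_powR; rewrite subr_gt0.
Qed.

Lemma norm_series_powRN_le u (B : R) s X : 0 < s -> (forall N, `|series u N| <= B) ->
  `|series (fun n => u n * n%:R `^ (- s)) X| <= 2 * B.
Proof.
move=> s0 uB; pose b (n : nat) : R := n%:R `^ (- s).
have B0 : 0 <= B by exact: le_trans (uB 0%N).
have total_variation n : b n.+1 + \sum_(0 <= k < n.+1) `|b k - b k.+1| <= 2.
  elim: n => [|n IH].
    by rewrite big_nat1 /b powR1 powR0 ?oppr_eq0 ?gt_eqF// sub0r normrN normr1.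
  rewrite big_nat_recr//= [X in _ + (_ + X)]ger0_norm; last first.
    by rewrite subr_ge0 powRN_succ_le// ltW.
  by move: IH; move: (\sum_(_ <= _ < _) _) => ?; lra.
rewrite (abel_summation u b) (le_trans (ler_normD _ _))//.
case: X => [|X].
  by rewrite /series/= !big_geq// mul0r !normr0 addr0 mulr_ge0.
rewrite [leRHS]mulrC; apply: le_trans (ler_wpM2l B0 (total_variation X)).
rewrite mulrDr; apply: lerD.
  by rewrite normrM (ger0_norm (powR_ge0 _ _)) ler_wpM2r ?powR_ge0.
rewrite /series/= (le_trans (ler_norm_sum _ _ _))// mulr_sumr; apply: ler_sum => n _.
by rewrite normrM ler_wpM2r//; exact: uB n.+1.
Qed.

End SummationByParts.

Section DirichletTaylor.
Variable R : realType.
Implicit Types (r a d C c : R) (u v : nat -> R).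

(* [pow_taylor a n k] is, up to the sign [(-1) ^ k], the [k]-th Taylor coefficient
   of [s |-> n ^ (- s)] at [s = a]; it vanishes at [n = 0] as soon as [a != 0]. *)
Definition pow_taylor a (n k : nat) : R := exp_coeff (ln n%:R) k * n%:R `^ (- a).

Lemma pow_taylor_ge0 a n k : 0 <= pow_taylor a n k.
Proof. by rewrite mulr_ge0 ?powR_ge0// exp_coeff_ge0// ln_nat_ge0. Qed.

Lemma pow_taylor_at0 a k : a != 0 -> pow_taylor a 0 k = 0.
Proof. by move=> a0; rewrite /pow_taylor powR0 ?mulr0// oppr_eq0. Qed.

Lemma pow_taylor_ord0 a n : pow_taylor a n 0 = n%:R `^ (- a).
Proof. by rewrite /pow_taylor /exp_coeff/= expr0 fact0 divr1 mul1r. Qed.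

Lemma pow_taylorM a m n : (0 < m)%N -> (0 < n)%N ->
  pow_taylor a (m * n) =1 cauchy_prod (pow_taylor a m) (pow_taylor a n).
Proof.
move=> m0 n0 k; rewrite /pow_taylor natrM lnM ?posrE ?ltr0n// exp_coeffD.
rewrite powRM// /cauchy_prod mulr_suml; apply: eq_bigr => j _; ring.
Qed.

Lemma formal_deriv_pow_taylor a n k :
  formal_deriv (pow_taylor a n) k = ln n%:R * pow_taylor a n k.
Proof.
rewrite /formal_deriv /pow_taylor mulrA -/(formal_deriv _ _).
by rewrite formal_deriv_exp_coeff mulrA.
Qed.

Lemma wnorm_pow_taylor r a n K : 0 <= r -> (0 < n)%N ->
  wnorm r K (pow_taylor a n) <= n%:R `^ (r - a).
Proof.
move=> r0 n0; rewrite powR_natD// mulrC.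
rewrite (@eq_wnorm _ _ _ _ (fun k => n%:R `^ (- a) * exp_coeff (ln n%:R) k)); last first.
  by move=> k; rewrite mulrC.
rewrite wnormZ (ger0_norm (powR_ge0 _ _)) ler_wpM2l ?powR_ge0//.
by rewrite powR_natE// wnorm_exp_coeff// ln_nat_ge0.
Qed.

Lemma cvg_wnorm_pow_taylor r a n : (0 < n)%N ->
  wnorm r ^~ (pow_taylor a n) @ \oo --> n%:R `^ (r - a).
Proof.
move=> n0.
rewrite (_ : wnorm r ^~ _ =
    fun K => series (exp_coeff (r * ln n%:R)) K * n%:R `^ (- a)); last first.
  apply/funext => K; rewrite -wnorm_exp_coeffE ?ln_nat_ge0// mulrC.
  rewrite -[X in X * _](ger0_norm (powR_ge0 _ _)) -wnormZ.
  by apply: eq_wnorm => k; rewrite mulrC.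
rewrite powR_natD// (powR_natE r)//; apply: cvgM; last exact: cvg_cst.
exact: is_cvg_series_exp_coeff.
Qed.

Lemma pow_taylor_le r a n k : 0 < r -> (0 < n)%N ->
  pow_taylor a n k <= r ^- k * n%:R `^ (r - a).
Proof.
move=> r0 n0; rewrite mulrC ler_pdivlMr ?exprn_gt0//.
rewrite (le_trans _ (wnorm_pow_taylor a k.+1 (ltW r0) n0))// /wnorm big_ord_recr/=.
rewrite (ger0_norm (pow_taylor_ge0 _ _ _)) lerDr sumr_ge0// => i _.
by rewrite mulr_ge0// exprn_ge0// ltW.
Qed.

Lemma wnorm_pow_taylorB r a n K : 0 <= r <= 1 -> 0 <= a <= 2 -> (0 < n)%N ->
  wnorm r K (fun k => pow_taylor a n k - pow_taylor a n.+1 k)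
    <= 5 * n%:R `^ (r - a - 1).
Proof.
move=> /[dup] r01 /andP[r0 r1] /andP[a0 a2] n0.
have ln_le : 0 <= ln (n%:R : R) <= ln n.+1%:R by rewrite ln_nat_ge0 ler_ln_nat.
pose exp_part k := n%:R `^ (- a) * (exp_coeff (ln n.+1%:R) k - exp_coeff (ln n%:R) k).
pose pow_part k := (n%:R `^ (- a) - n.+1%:R `^ (- a)) * exp_coeff (ln n.+1%:R) k.
rewrite (@eq_wnorm _ _ _ _ (fun k => pow_part k - exp_part k)); last first.
  by move=> k; rewrite /pow_taylor /exp_part /pow_part; ring.
rewrite (le_trans (wnormB _ _ _ r0))// addrC !wnormZ.
rewrite !ger0_norm ?powR_ge0 ?subr_ge0 ?powRN_succ_le//.
have exp_part_le : wnorm r K (fun k => exp_coeff (ln n.+1%:R) k - exp_coeff (ln n%:R) k)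
    <= n%:R `^ (r - 1).
  rewrite (le_trans (wnorm_exp_coeffB _ _ _))// -!powR_natE// powR_natD// powR_inv1//.
  by have := powR_succ_le n0 r01; rewrite mulrDr mulr1 lerBlDl.
have pow_part_le : wnorm r K (exp_coeff (ln n.+1%:R)) <= 2 * n%:R `^ r.
  by rewrite (le_trans (wnorm_exp_coeff _ _ _)) ?ln_nat_ge0// -powR_natE// powR_succ_le2.
apply: (@le_trans _ _ (n%:R `^ (- a) * n%:R `^ (r - 1) +
    (a * n%:R `^ (- a - 1)) * (2 * n%:R `^ r))).
  apply: lerD; first by rewrite ler_wpM2l ?powR_ge0.
  apply: ler_pM => //; rewrite ?subr_ge0 ?powRN_succ_le ?wnorm_ge0//.
  exact: powRN_sub_succ_le.
rewrite [X in _ + X](_ : _ = (2 * a) * (n%:R `^ (- a - 1) * n%:R `^ r)); last by ring.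
rewrite -!powR_natD// (_ : - a + (r - 1) = r - a - 1); last by ring.
rewrite (_ : - a - 1 + r = r - a - 1); last by ring.
rewrite -[X in X + _]mul1r -mulrDl ler_wpM2r ?powR_ge0//; lra.
Qed.

Definition abel_const d : R := 1 + 5 * (1 + (d / 2)^-1).

Lemma abel_const_ge0 d : 0 < d -> 0 <= abel_const d.
Proof.
move=> d0; have : 0 <= (d / 2)^-1 by rewrite invr_ge0 divr_ge0// ltW.
rewrite /abel_const; lra.
Qed.

Lemma wnorm_dirichlet_boundary_term a d C u K X : 0 < d < 1 -> 1 <= a ->
  sums_le_powR C (1 - d) u ->
  wnorm (d / 2) K (fun k => series u X * pow_taylor a X k) <= C.
Proof.
move=> /andP[d0 d1] a1 uC; have C0 := sums_le_powR_ge0 uC.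
rewrite wnormZ; case: X => [|X]; first by rewrite /series/= big_geq// normr0 mul0r.
apply: (@le_trans _ _ (C * X.+1%:R `^ (1 - d) * X.+1%:R `^ (d / 2 - a))).
  rewrite ler_pM ?wnorm_ge0 ?wnorm_pow_taylor ?divr_ge0 ?(ltW d0)//.
  by rewrite (le_trans (uC X))// ler_wpM2l// ge0_ler_powR ?nnegrE ?ler_nat//; lra.
by rewrite -mulrA -powR_natD// ler_piMr// powR_nat_le1//; lra.
Qed.

Lemma wnorm_dirichlet_increment_term a d C u K n : 0 < d < 1 -> 1 <= a <= 2 ->
  sums_le_powR C (1 - d) u ->
  wnorm (d / 2) K (fun k => series u n.+1 * (pow_taylor a n k - pow_taylor a n.+1 k))
    <= C * (5 * n%:R `^ (- 1 - d / 2)).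
Proof.
move=> /andP[d0 d1] /andP[a1 a2] uC; have C0 := sums_le_powR_ge0 uC.
rewrite wnormZ; case: n => [|n].
  rewrite (sums_le_powR_at0 _ uC); last by rewrite gt_eqF//; lra.
  by rewrite normr0 mul0r !mulr_ge0 ?powR_ge0.
apply: (@le_trans _ _ (C * n.+1%:R `^ (1 - d) * (5 * n.+1%:R `^ (d / 2 - a - 1)))).
  by rewrite ler_pM ?wnorm_ge0 ?uC ?wnorm_pow_taylorB ?divr_ge0//; lra.
rewrite -mulrA ler_wpM2l// mulrCA ler_wpM2l// -powR_natD// ler_powR_nat//; lra.
Qed.

Lemma wnorm_dirichlet_partial_sum a d C u K X : 0 < d < 1 -> 1 <= a <= 2 ->
  sums_le_powR C (1 - d) u ->
  wnorm (d / 2) K (fun k => series (fun n => u n * pow_taylor a n k) X)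
    <= C * abel_const d.
Proof.
move=> d01 a12 uC; have C0 := sums_le_powR_ge0 uC.
have [d0 a1] : 0 < d /\ 1 <= a by case/andP: d01; case/andP: a12.
have d2_gt0 : 0 < d / 2 by rewrite divr_gt0.
rewrite (@eq_wnorm _ _ _ _ (fun k => series u X * pow_taylor a X k + \sum_(0 <= n < X)
    series u n.+1 * (pow_taylor a n k - pow_taylor a n.+1 k))); last first.
  by move=> k; rewrite (abel_summation u (fun n => pow_taylor a n k)).
rewrite (le_trans (wnormD _ _ _ (ltW d2_gt0)))// /abel_const mulrDr lerD//.
  by rewrite mulr1; exact: wnorm_dirichlet_boundary_term.
rewrite (le_trans (wnorm_sum _ _ _ _ (ltW d2_gt0)))//.
apply: (@le_trans _ _ (C * (5 * series (fun n => n%:R `^ (- 1 - d / 2)) X))).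
  rewrite /series/= !mulr_sumr; apply: ler_sum => n _.
  exact: wnorm_dirichlet_increment_term.
by rewrite ler_wpM2l// ler_wpM2l// series_powR_le.
Qed.

Lemma is_cvg_series_pow_taylor a k : 1 < a -> cvgn (series (fun n => pow_taylor a n k)).
Proof.
move=> a1; pose h := (a - 1) / 2; have h0 : 0 < h by rewrite divr_gt0// subr_gt0.
have pow_taylor_dom n : pow_taylor a n k <= h ^- k * n%:R `^ (- 1 - h).
  case: n => [|n].
    rewrite pow_taylor_at0 ?gt_eqF ?(lt_trans ltr01)//.
    by rewrite mulr_ge0 ?powR_ge0 ?invr_ge0 ?exprn_ge0// ltW.
  rewrite (_ : - 1 - h = h - a) ?pow_taylor_le//.
  by rewrite /h; field.
apply: (series_le_cvg _ _ pow_taylor_dom) => [n|n|]; first exact: pow_taylor_ge0.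
  by apply: le_trans (pow_taylor_dom n); exact: pow_taylor_ge0.
by apply: is_cvg_seriesZ; exact: is_cvg_series_powR.
Qed.

Definition dirichlet_taylor a u (k : nat) : R :=
  limn (series (fun n => u n * pow_taylor a n k)).

Lemma cvg_dirichlet_taylor a u c k : 1 < a -> (forall n, `|u n| <= c) ->
  series (fun n => u n * pow_taylor a n k) @ \oo --> dirichlet_taylor a u k.
Proof.
move=> a1 uc; suff : cvgn (series (fun n => u n * pow_taylor a n k)) by [].
apply: normed_cvg.
apply: (@series_le_cvg _ _ (fun n => c * pow_taylor a n k)) => [n|n|n|] /=.
- exact: normr_ge0.
- by rewrite mulr_ge0 ?pow_taylor_ge0// (le_trans _ (uc n)).
- by rewrite normrM (ger0_norm (pow_taylor_ge0 _ _ _)) ler_wpM2r ?pow_taylor_ge0.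
- by apply: is_cvg_seriesZ; exact: is_cvg_series_pow_taylor.
Qed.

Lemma cvg_formal_deriv_dirichlet_taylor a u c k : 1 < a -> (forall n, `|u n| <= c) ->
  series (fun n => ln n%:R * u n * pow_taylor a n k) @ \oo -->
    formal_deriv (dirichlet_taylor a u) k.
Proof.
move=> a1 uc.
rewrite (_ : series _ =
    fun X => k.+1%:R * series (fun n => u n * pow_taylor a n k.+1) X).
  by apply: cvgM; [exact: cvg_cst|exact: cvg_dirichlet_taylor uc].
apply/funext => X; rewrite /series/= mulr_sumr; apply: eq_bigr => n _.
by rewrite mulrAC -formal_deriv_pow_taylor mulrC mulrCA.
Qed.

Lemma is_cvg_series_ln_pow_taylor a k : 1 < a ->
  cvgn (series (fun n => ln n%:R * pow_taylor a n k)).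
Proof.
move=> a1; have norm1_le1 (n : nat) : `|1 : R| <= 1 by rewrite normr1.
have := cvg_formal_deriv_dirichlet_taylor (u := fun=> 1) (k := k) a1 norm1_le1.
under eq_fun do rewrite mulr1.
by move=> h; apply/cvg_ex; exists (formal_deriv (dirichlet_taylor a (fun=> 1)) k).
Qed.

Lemma dirichlet_taylorD a u v c c' k : 1 < a ->
  (forall n, `|u n| <= c) -> (forall n, `|v n| <= c') ->
  dirichlet_taylor a (fun n => u n + v n) k =
  dirichlet_taylor a u k + dirichlet_taylor a v k.
Proof.
move=> a1 uc vc; apply: cvg_lim => //.
rewrite (_ : series _ = series (fun n => u n * pow_taylor a n k) +
    series (fun n => v n * pow_taylor a n k)).
  by apply: cvgD; [exact: cvg_dirichlet_taylor uc|exact: cvg_dirichlet_taylor vc].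
apply/funext => X; rewrite -[RHS]/(series _ X + series _ X) /series/= -big_split.
by apply: eq_bigr => n _; rewrite mulrDl.
Qed.

Lemma wnorm_dirichlet_taylor a d C c u K : 0 < d < 1 -> 1 < a <= 2 ->
  (forall n, `|u n| <= c) -> sums_le_powR C (1 - d) u ->
  wnorm (d / 2) K (dirichlet_taylor a u) <= C * abel_const d.
Proof.
move=> d01 /andP[a1 a2] uc uC.
apply: (@wnorm_lim_le _ _ _ (fun X k => series (fun n => u n * pow_taylor a n k) X)).
  by move=> X; apply: wnorm_dirichlet_partial_sum => //; rewrite (ltW a1).
by move=> k; exact: cvg_dirichlet_taylor uc.
Qed.

(* Landau's argument: all the terms are nonnegative, so the sums over [n] and over
   the Taylor coefficients at [a] can be exchanged. *)
Lemma sum_powR_le_wnorm r a u c M X : 0 <= r < a -> 1 < a ->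
  (forall n, 0 <= u n <= c) ->
  (forall K, wnorm r K (dirichlet_taylor a u) <= M) ->
  \sum_(0 <= n < X) u n * n%:R `^ (r - a) <= M.
Proof.
move=> /andP[r0 ra] a1 u0c normM.
have u_norm n : `|u n| <= c by case/andP: (u0c n) => ? ?; rewrite ger0_norm.
have coeff_ge0 n k : 0 <= u n * pow_taylor a n k.
  by case/andP: (u0c n) => ? _; rewrite mulr_ge0// pow_taylor_ge0.
pose partial K := \sum_(0 <= n < X) u n * wnorm r K (pow_taylor a n).
have partial_le K : partial K <= M.
  apply: le_trans (normM K); rewrite /partial.
  under eq_bigr do rewrite mulr_sumr.
  rewrite exchange_big/=; apply: ler_sum => k _.
  under eq_bigr do rewrite (ger0_norm (pow_taylor_ge0 _ _ _)) mulrA.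
  rewrite -mulr_suml ler_wpM2r ?exprn_ge0// (le_trans _ (ler_norm _))//.
  apply: nondecreasing_cvgn_le; first exact: nondecreasing_series.
  by apply/cvg_ex; exists (dirichlet_taylor a u k); exact: cvg_dirichlet_taylor u_norm.
have cvg_partial : partial @ \oo --> \sum_(0 <= n < X) u n * n%:R `^ (r - a).
  apply: (@cvg_sumr _ _ _ (fun n K => u n * wnorm r K (pow_taylor a n))) => n.
  apply: cvgM; first exact: cvg_cst.
  case: n => [|n]; last by apply: cvg_wnorm_pow_taylor.
  rewrite powR0 ?subr_eq0 ?lt_eqF//.
  rewrite (_ : (fun K => _) = cst 0); first exact: cvg_cst.
  apply/funext => K; rewrite /wnorm big1// => k _.
  by rewrite pow_taylor_at0 ?normr0 ?mul0r ?gt_eqF// (lt_trans ltr01).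
by apply: (cvgr_to_le cvg_partial); near=> K.
Unshelve. all: by end_near. Qed.

End DirichletTaylor.

Section Multiples.
Variable R : realType.
Implicit Types (u v : nat -> R) (a c : R) (p m n : nat).

Definition multiple_part p u n : R := if (p %| n)%N then u n else 0.

Definition coprime_part p u n : R := if (p %| n)%N then 0 else u n.

Lemma coprime_multiple_partD p u :
  u = (fun n => coprime_part p u n + multiple_part p u n).
Proof.
apply/funext => n; rewrite /coprime_part /multiple_part.
by case: ifP; rewrite ?add0r ?addr0.
Qed.

Lemma multiple_part_norm_le p u c : (forall n, `|u n| <= c) ->
  forall n, `|multiple_part p u n| <= c.
Proof.
by move=> uc n; rewrite /multiple_part; case: ifP; rewrite // normr0 (le_trans _ (uc n)).
Qed.

Lemma coprime_part_norm_le p u c : (forall n, `|u n| <= c) ->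
  forall n, `|coprime_part p u n| <= c.
Proof.
by move=> uc n; rewrite /coprime_part; case: ifP; rewrite // normr0 (le_trans _ (uc n)).
Qed.

Lemma dirichlet_taylor_coprimeD a p u c k : 1 < a -> (forall n, `|u n| <= c) ->
  dirichlet_taylor a u k =
  dirichlet_taylor a (coprime_part p u) k + dirichlet_taylor a (multiple_part p u) k.
Proof.
move=> a1 uc; rewrite {1}(coprime_multiple_partD p u).
exact: dirichlet_taylorD a1 (coprime_part_norm_le p uc) (multiple_part_norm_le p uc).
Qed.

Lemma sum_multiples u p n : (0 < p)%N ->
  \sum_(0 <= k < n.+1 | (p %| k)%N) u k = \sum_(0 <= m < (n %/ p).+1) u (p * m)%N.
Proof.
move=> p0; elim: n => [|n IH].
  by rewrite div0n big_mkcond !big_nat1 dvdn0 muln0.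
rewrite big_mkcond big_nat_recr//= -big_mkcond/= IH divnS//.
case: ifPn => [pn|_]; last by rewrite add0n addr0.
rewrite add1n [in RHS]big_nat_recr//=; congr (_ + u _).
by have := divnK pn; rewrite divnS// pn add1n mulnC => ->.
Qed.

Lemma cvg_muln_succ u (l : R) p : (0 < p)%N ->
  u @ \oo --> l -> (fun X => u (p * X).+1) @ \oo --> l.
Proof.
move=> p0 ul; apply: cvg_trans ul => A [N _ hN].
exists N => // X /= NX; apply: hN => /=.
by rewrite (leq_trans NX)// ltnW// ltnS leq_pmull.
Qed.

Lemma dirichlet_taylor_multiple_part a p u v (x cu cv : R) k : 1 < a -> (0 < p)%N ->
  (forall n, `|u n| <= cu) -> (forall n, `|v n| <= cv) ->
  (forall m, (0 < m)%N -> u (p * m)%N = x * v m) ->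
  dirichlet_taylor a (multiple_part p u) k =
  x * cauchy_prod (pow_taylor a p) (dirichlet_taylor a v) k.
Proof.
move=> a1 p0 ucu vcv upE.
have a_neq0 : a != 0 by rewrite gt_eqF// (lt_trans ltr01).
pose taylor w X i := series (fun n => w n * pow_taylor a n i) X.
have taylorE X : taylor (multiple_part p u) (p * X).+1 k =
    x * cauchy_prod (pow_taylor a p) (taylor v X.+1) k.
  transitivity (\sum_(0 <= n < (p * X).+1 | (p %| n)%N) u n * pow_taylor a n k).
    rewrite [RHS]big_mkcond; apply: eq_bigr => n _.
    by rewrite /multiple_part; case: ifP => _; rewrite ?mul0r.
  rewrite sum_multiples// mulKn// /cauchy_prod /taylor /series/=.
  rewrite mulr_sumr; under [RHS]eq_bigr do rewrite !mulr_sumr.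
  rewrite exchange_big/=; apply: eq_bigr => -[|m] _.
    by rewrite muln0 pow_taylor_at0// mulr0 big1// => j _; rewrite pow_taylor_at0 ?mulr0.
  rewrite upE// pow_taylorM// /cauchy_prod mulr_sumr.
  by apply: eq_bigr => j _; ring.
have cvg_left := cvg_muln_succ p0
  (cvg_dirichlet_taylor (k := k) a1 (multiple_part_norm_le p ucu)).
rewrite -(cvg_lim _ cvg_left)//; apply: cvg_lim => //.
under eq_fun do rewrite -/(taylor _ _ _) taylorE.
apply: cvgM; first exact: cvg_cst.
apply: cvg_cauchy_prodr => i; rewrite (@cvg_shiftS R (taylor v ^~ i)).
exact: cvg_dirichlet_taylor vcv.
Qed.

End Multiples.

Section PrimeDivisors.
Variable R : realType.
Implicit Types (p n X : nat).

Definition ln_prime_divisors X n : R :=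
  \sum_(0 <= p < X | prime p && (p %| n)%N) ln p%:R.

Lemma ln_natE n X : (0 < n < X)%N ->
  ln n%:R = \sum_(0 <= p < X) (logn p n)%:R * ln p%:R :> R.
Proof.
case: X => [|X] /andP[n0 nX] //.
suff nE : n%:R = expR (\sum_(0 <= p < X.+1) (logn p n)%:R * ln p%:R) :> R.
  by rewrite nE expRK.
rewrite -{1}(partnT n0) (@widen_partn X)// natr_prod expR_sum.
apply: eq_bigr => p _; rewrite expRM_natl natrX.
have [p0|p0] := posnP p; last by rewrite lnK// posrE ltr0n.
by rewrite p0 lognE.
Qed.

Lemma ln_prime_divisors_ge0 X n : 0 <= ln_prime_divisors X n.
Proof. by apply: sumr_ge0 => p _; exact: ln_nat_ge0. Qed.

Lemma ln_prime_divisors_le X n : (0 < n)%N -> ln_prime_divisors X n <= ln n%:R.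
Proof.
move=> n0; rewrite (@ln_natE n (maxn X n.+1)); last by rewrite n0 leq_max leqnn orbT.
rewrite [leRHS](big_cat_nat (n := X)) ?leq_maxl//= -[leLHS]addr0.
apply: lerD; last by apply: sumr_ge0 => p _; rewrite mulr_ge0// ln_nat_ge0.
rewrite /ln_prime_divisors big_mkcond; apply: ler_sum => p _.
case: ifPn => [/andP[pp pn]|_]; last by rewrite mulr_ge0// ln_nat_ge0.
by rewrite ler_peMl ?ln_nat_ge0// ler1n logn_gt0 mem_primes pp n0.
Qed.

Lemma ln_squarefree X n : squarefree n -> (n < X)%N ->
  ln n%:R = ln_prime_divisors X n.
Proof.
move=> /andP[n0 /allP n_sqf] nX; rewrite (@ln_natE n X) ?n0//.
rewrite /ln_prime_divisors [RHS]big_mkcond; apply: eq_bigr => p _.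
case: ifPn => [/andP[pp pn]|p_ndiv].
  by rewrite (eqP (n_sqf p _)) ?mul1r// mem_primes pp n0.
suff -> : logn p n = 0%N by rewrite mul0r.
apply/eqP; rewrite -leqn0 leqNgt logn_gt0 mem_primes n0/=.
exact: p_ndiv.
Qed.

End PrimeDivisors.

Section SquarefreeExtension.
Variable R : realType.
Implicit Types (x y : nat -> R) (p q m n N : nat).

Definition squarefree_ext x n : R :=
  (squarefree n)%:R * \prod_(p <- primes n) x p.

Definition on_primes x n : R := if prime n then x n else 0.

Definition primes_norm_le1 x : Prop := forall p, prime p -> `|x p| <= 1.

Definition sift N x p : R := if (p < N)%N then 0 else x p.

Lemma primes_mul_perm p m : prime p -> (0 < m)%N -> ~~ (p %| m)%N ->
  perm_eq (primes (p * m)) (p :: primes m).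
Proof.
move=> pp m0 pm; have p0 := prime_gt0 pp.
apply: uniq_perm; first exact: primes_uniq.
  by rewrite /= primes_uniq andbT mem_primes pp m0.
by move=> q; rewrite primesM// inE primes_prime// inE.
Qed.

Lemma squarefree_mul p m : prime p -> (0 < m)%N ->
  squarefree (p * m) = ~~ (p %| m)%N && squarefree m.
Proof.
move=> pp m0; have p0 := prime_gt0 pp.
have [pm|pm] /= := boolP (p %| m)%N.
  rewrite /squarefree muln_gt0 p0 m0/=; apply/negP => /allP/(_ p).
  rewrite primesM// primes_prime// mem_seq1 eqxx => /(_ isT).
  rewrite lognM// logn_prime// eqxx add1n eqSS.
  by rewrite -leqn0 leqNgt logn_gt0 mem_primes pp m0 pm.
rewrite /squarefree muln_gt0 p0 m0/= (perm_all _ (primes_mul_perm pp m0 pm))/=.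
rewrite lognM// logn_prime// eqxx (_ : logn p m = 0%N) ?eqxx/=; last first.
  by apply/eqP; rewrite -leqn0 leqNgt logn_gt0 mem_primes pp m0 (negbTE pm).
apply: eq_in_all => q; rewrite mem_primes => /and3P[pq _ qm].
rewrite lognM// logn_prime// (_ : (q == p) = false)//.
by apply/eqP => qp; rewrite -qp qm in pm.
Qed.

Lemma eq_squarefree_ext x y : (forall p, prime p -> x p = y p) ->
  squarefree_ext x = squarefree_ext y.
Proof.
move=> xy; apply/funext => n; congr (_ * _); apply: eq_big_seq => p.
by rewrite mem_primes => /andP[pp _]; exact: xy.
Qed.

Lemma squarefree_ext0 x : squarefree_ext x 0 = 0.
Proof. by rewrite /squarefree_ext mul0r. Qed.

Lemma squarefree_ext1 x : squarefree_ext x 1 = 1.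
Proof. by rewrite /squarefree_ext big_nil mulr1. Qed.

Lemma squarefree_ext_eq0 x n : ~~ squarefree n -> squarefree_ext x n = 0.
Proof. by move=> /negbTE n_sqf; rewrite /squarefree_ext n_sqf mul0r. Qed.

Lemma squarefree_ext_norm_le1 x : primes_norm_le1 x ->
  forall n, `|squarefree_ext x n| <= 1.
Proof.
move=> x1 n; rewrite normrM normr_nat mulr_ile1 ?lern1 ?leq_b1// normr_prod.
rewrite big_seq prodr_ile1// => p; rewrite mem_primes => /andP[pp _].
by rewrite normr_ge0 x1.
Qed.

Lemma squarefree_ext_mul x p m : prime p -> (0 < m)%N ->
  squarefree_ext x (p * m)%N = x p * coprime_part p (squarefree_ext x) m.
Proof.
move=> pp m0; rewrite /squarefree_ext /coprime_part squarefree_mul//.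
case: ifPn => [_|pm]; first by rewrite mul0r mulr0.
by rewrite (perm_big _ (primes_mul_perm pp m0 pm))/= big_cons mulrCA.
Qed.

Lemma sift0 x : sift 0 x = x.
Proof. by apply/funext. Qed.

Lemma sift_norm_le1 N x : primes_norm_le1 x ->
  primes_norm_le1 (sift N x).
Proof. by move=> x1 p pp; rewrite /sift; case: ifP; rewrite ?normr0 ?x1. Qed.

Lemma siftS_nprime N x : ~~ prime N ->
  squarefree_ext (sift N.+1 x) = squarefree_ext (sift N x).
Proof.
move=> Np; apply: eq_squarefree_ext => p pp; rewrite /sift ltnS leq_eqVlt.
by case: eqP => // pN; rewrite pN (negbTE Np) in pp.
Qed.

Lemma coprime_part_sift N x : prime N ->
  coprime_part N (squarefree_ext (sift N x)) = squarefree_ext (sift N.+1 x).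
Proof.
move=> Np; apply/funext => n; rewrite /coprime_part /squarefree_ext.
have [->|n0] := posnP n; first by rewrite dvdn0 mul0r.
case: ifPn => Nn.
  rewrite (big_rem N) ?mem_primes ?Np ?n0//=.
  by rewrite /sift ltnSn mul0r mulr0.
congr (_ * _); apply: eq_big_seq => q; rewrite mem_primes => /and3P[_ _ qn].
rewrite /sift [in RHS]ltnS [in RHS]leq_eqVlt; case: eqP => // qN.
by rewrite qN (negbTE Nn) in qn.
Qed.

Lemma squarefree_ext_sift_lt N x n : (n < N)%N ->
  squarefree_ext (sift N x) n = (n == 1%N)%:R.
Proof.
case: n => [|[|n]] nN; rewrite ?squarefree_ext0 ?squarefree_ext1//.
have pdiv_mem : pdiv n.+2 \in primes n.+2 by rewrite pi_pdiv.
rewrite /squarefree_ext (big_rem _ pdiv_mem)/= /sift.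
by rewrite (leq_ltn_trans (pdiv_leq _) nN)// mul0r mulr0.
Qed.

End SquarefreeExtension.

Section EulerProduct.
Variables (R : realType) (a : R).
Hypothesis a_gt1 : 1 < a.
Implicit Types (x : nat -> R) (p N X : nat) (B : R).

Lemma dirichlet_taylor_multiple_ext x p k :
  primes_norm_le1 x -> prime p ->
  dirichlet_taylor a (multiple_part p (squarefree_ext x)) k =
  x p * cauchy_prod (pow_taylor a p)
          (dirichlet_taylor a (coprime_part p (squarefree_ext x))) k.
Proof.
move=> x1 pp; have ext1 := squarefree_ext_norm_le1 x1.
apply: dirichlet_taylor_multiple_part a_gt1 (prime_gt0 pp) ext1
  (coprime_part_norm_le p ext1) _ => m.
exact: squarefree_ext_mul.
Qed.

Lemma dirichlet_taylor_sift x N : primes_norm_le1 x ->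
  dirichlet_taylor a (squarefree_ext (sift N x)) 0 =
  (if prime N then 1 + x N * N%:R `^ (- a) else 1) *
    dirichlet_taylor a (squarefree_ext (sift N.+1 x)) 0.
Proof.
move=> x1; case: ifPn => [Np|Np]; last by rewrite mul1r siftS_nprime.
have xN1 := sift_norm_le1 N x1.
rewrite (dirichlet_taylor_coprimeD N _ a_gt1 (squarefree_ext_norm_le1 xN1)).
rewrite dirichlet_taylor_multiple_ext// coprime_part_sift//.
rewrite /cauchy_prod big_ord1 pow_taylor_ord0 /sift ltnn.
by rewrite mulrDl mul1r mulrA.
Qed.

Lemma dirichlet_taylor_euler x N : primes_norm_le1 x ->
  dirichlet_taylor a (squarefree_ext x) 0 =
  \prod_(0 <= p < N | prime p) (1 + x p * p%:R `^ (- a)) *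
    dirichlet_taylor a (squarefree_ext (sift N x)) 0.
Proof.
move=> x1; elim: N => [|N ->]; first by rewrite big_geq// mul1r sift0.
rewrite dirichlet_taylor_sift// mulrA.
by rewrite [in RHS]big_mkcond/= [in RHS]big_nat_recr//= -big_mkcond.
Qed.

Lemma dirichlet_taylor_sift_ge x : primes_norm_le1 x ->
  exists N, 2^-1 <= dirichlet_taylor a (squarefree_ext (sift N x)) 0.
Proof.
move=> x1; pose tau n := pow_taylor a n 0.
have tau_ge0 n : 0 <= tau n by exact: pow_taylor_ge0.
have cvg_tau : cvgn (series tau) by exact: is_cvg_series_pow_taylor.
have half_gt0 : 0 < 2^-1 :> R by rewrite invr_gt0.
have /cvgrPdist_lt/(_ _ half_gt0)[N0 _ tail_lt] := cvg_tau.
pose N := N0.+2; exists N.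
have ext1 := squarefree_ext_norm_le1 (sift_norm_le1 N x1).
apply: (cvgr_to_ge (cvg_dirichlet_taylor (k := 0) a_gt1 ext1)); near=> X.
have NX : (N <= X)%N by near: X; exact: nbhs_infty_ge.
rewrite /series/= (big_cat_nat (n := N))//=.
have -> : \sum_(0 <= n < N) squarefree_ext (sift N x) n * tau n = 1.
  rewrite (eq_big_nat _ _ (F2 := fun n => if n == 1%N then 1 else 0)); last first.
    move=> n /andP[_ nN]; rewrite squarefree_ext_sift_lt//.
    by case: eqP => [->|_]; rewrite ?mul0r// /tau pow_taylor_ord0 powR1 mulr1.
  by rewrite -big_mkcond big_nat1_eq.
have tail_le : `|\sum_(N <= n < X) squarefree_ext (sift N x) n * tau n|
    <= \sum_(N <= n < X) tau n.
  rewrite (le_trans (ler_norm_sum _ _ _))//; apply: ler_sum => n _.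
  by rewrite normrM (ger0_norm (tau_ge0 _)) ler_piMl.
have tau_tail : \sum_(N <= n < X) tau n <= 2^-1.
  have nd_tau : nondecreasing_seq (series tau) by exact: nondecreasing_series.
  rewrite -(sub_series_geq _ NX) ltW// (le_lt_trans _ (tail_lt N _))//.
    by rewrite (le_trans _ (ler_norm _))// lerB// nondecreasing_cvgn_le.
  by rewrite /= /N; lia.
have := le_trans tail_le tau_tail; rewrite ler_norml => /andP[+ _]; lra.
Unshelve. all: by end_near. Qed.

Lemma norm_series_on_primes_powRN_le x B X :
  (forall N, `|series (on_primes (fun p => x p / p%:R)) N| <= B) ->
  `|series (fun p => on_primes x p * p%:R `^ (- a)) X| <= 2 * B.
Proof.
move=> sumsB; have a1 : 0 < a - 1 by rewrite subr_gt0.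
rewrite [series _ _](_ : _ = series (fun p =>
    on_primes (fun p => x p / p%:R) p * p%:R `^ (- (a - 1))) X).
  exact: norm_series_powRN_le.
apply: eq_bigr => p _; rewrite /on_primes; case: ifP => pp; last by rewrite !mul0r.
have p0 := prime_gt0 pp; rewrite opprB powR_natD// powRr1//.
by rewrite mulrA divfK// pnatr_eq0 -lt0n.
Qed.

Definition euler_bound B : R := expR (- (2 * B) - 4) / 2.

Lemma euler_bound_gt0 B : 0 < euler_bound B.
Proof. by rewrite divr_gt0 ?expR_gt0. Qed.

(* Each factor satisfies [1 + y >= expR (y - 2 y ^ 2)], and the sum of the squares
   is at most [2]. *)
Lemma dirichlet_taylor_ext_ge x B : primes_norm_le1 x ->
  (forall N, `|series (on_primes (fun p => x p / p%:R)) N| <= B) ->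
  euler_bound B <= dirichlet_taylor a (squarefree_ext x) 0.
Proof.
move=> x1 sumsB; have [N N_ge] := dirichlet_taylor_sift_ge x1.
pose y p : R := x p * p%:R `^ (- a).
have y_le p : prime p -> `|y p| <= p%:R `^ (- 1).
  move=> pp; rewrite normrM (ger0_norm (powR_ge0 _ _)).
  rewrite (le_trans (ler_piMl _ (x1 p pp))) ?powR_ge0//.
  by rewrite ler_powR_nat ?prime_gt0// lerN2 ltW.
have sum_y : - (2 * B) <= \sum_(0 <= p < N | prime p) y p.
  rewrite (_ : \sum_(_ <= _ < _ | _) _ =
      series (fun p => on_primes x p * p%:R `^ (- a)) N).
    by have := norm_series_on_primes_powRN_le N sumsB; rewrite ler_norml => /andP[].
  rewrite big_mkcond; apply: eq_bigr => p _.
  by rewrite /on_primes /y; case: ifP; rewrite ?mul0r.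
have sum_yy : \sum_(0 <= p < N | prime p) (y p * y p) <= 2.
  apply: le_trans (_ : series (fun n => n%:R `^ (- 1 - 1)) N <= _); last first.
    by have := @series_powR_le R 1 N ltr01; rewrite invr1.
  rewrite /series/= big_mkcond/=; apply: ler_sum => p _.
  case: ifPn => [pp|_]; last exact: powR_ge0.
  rewrite powR_natD ?prime_gt0// -[y p * y p]ger0_norm -?expr2 ?sqr_ge0//.
  by rewrite expr2 normrM ler_pM ?y_le.
rewrite (dirichlet_taylor_euler N x1); apply: ler_pM => //.
apply: le_trans (expR_le_prod_1D _ _) => [|p pp]; first by rewrite ler_expR; lra.
apply: le_trans (y_le p pp) _; rewrite powR_inv1// lef_pV2 ?posrE ?ltr0n ?prime_gt0//.
by rewrite ler_nat prime_gt1.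
Qed.

End EulerProduct.

Section LogarithmicDerivative.
Variables (R : realType) (a : R) (x : nat -> R).
Hypothesis a_gt1 : 1 < a.
Hypothesis x_le1 : primes_norm_le1 x.
Implicit Types (r : R) (p k K X : nat).

Local Notation f := (squarefree_ext x).
Local Notation F := (dirichlet_taylor a f).

Definition multiples_taylor p : nat -> R := dirichlet_taylor a (multiple_part p f).

Definition prime_log_sum X k : R :=
  \sum_(0 <= p < X | prime p) ln p%:R * x p * pow_taylor a p k.

Definition prime_multiples_sum X k : R :=
  \sum_(0 <= p < X | prime p) ln p%:R * multiples_taylor p k.

Definition prime_square_sum X k : R := \sum_(0 <= p < X | prime p)
  ln p%:R * x p * cauchy_prod (pow_taylor a p) (multiples_taylor p) k.

Let f_le1 : forall n, `|f n| <= 1. Proof. exact: squarefree_ext_norm_le1. Qed.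

Lemma on_primes_norm_le1 n : `|on_primes x n| <= 1.
Proof. by rewrite /on_primes; case: ifP => [/x_le1//|_]; rewrite normr0. Qed.

Lemma multiples_taylorE p k : prime p ->
  multiples_taylor p k =
  x p * cauchy_prod (pow_taylor a p) (fun i => F i - multiples_taylor p i) k.
Proof.
move=> pp; rewrite /multiples_taylor dirichlet_taylor_multiple_ext//; congr (_ * _).
apply: eq_bigr => j _; congr (_ * _).
by rewrite (dirichlet_taylor_coprimeD p _ a_gt1 f_le1) addrK.
Qed.

Lemma cauchy_prod_prime_log_sum X k :
  cauchy_prod (prime_log_sum X) F k = prime_multiples_sum X k + prime_square_sum X k.
Proof.
rewrite /prime_multiples_sum /prime_square_sum -big_split/=.
rewrite {1}/cauchy_prod /prime_log_sum.
under [LHS]eq_bigr do rewrite mulr_suml.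
rewrite exchange_big/=; apply: eq_bigr => p pp.
rewrite {1}multiples_taylorE// mulrA -mulrDr /cauchy_prod -big_split/= mulr_sumr.
by apply: eq_bigr => j _; ring.
Qed.

(* As [p ^ (r - a) <= 3 / 4], [multiples_taylorE] can be solved for the norm of
   [multiples_taylor p]. *)
Lemma wnorm_multiples_taylor r p K : 0 <= r <= 4^-1 -> prime p ->
  wnorm r K (multiples_taylor p) <= 4 * p%:R `^ (r - a) * wnorm r K F.
Proof.
move=> /andP[r0 r4] pp.
have pow_le : p%:R `^ (r - a) <= 3 / 4.
  apply: le_trans (powR2N_le (s := 3 / 4) _); last lra.
  apply: powRN_nat_le; rewrite ?prime_gt1//; have := a_gt1; lra.
have norm_le : wnorm r K (multiples_taylor p) <=
    p%:R `^ (r - a) * (wnorm r K F + wnorm r K (multiples_taylor p)).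
  rewrite [leLHS](eq_wnorm _ _ (fun k => multiples_taylorE k pp)) wnormZ.
  rewrite (le_trans (ler_piMl _ (x_le1 pp))) ?wnorm_ge0//.
  apply: le_trans (wnorm_cauchy_prod _ _ _ r0) _.
  apply: ler_pM; rewrite ?wnorm_ge0 ?wnorm_pow_taylor ?prime_gt0//.
  exact: wnormB.
have := wnorm_ge0 K (multiples_taylor p) r0; have := wnorm_ge0 K F r0.
have := powR_ge0 p%:R (r - a).
move: norm_le pow_le; move: (_ `^ _) (wnorm _ _ F) (wnorm _ _ _) => q nF nM.
nra.
Qed.

Lemma wnorm_prime_square_sum r X K : 0 <= r <= 4^-1 ->
  wnorm r K (prime_square_sum X) <= 80 * wnorm r K F.
Proof.
move=> /[dup] r04 /andP[r0 r4]; have F_ge0 := wnorm_ge0 K F r0.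
have quarter_gt0 : 0 < 4^-1 :> R by rewrite invr_gt0.
apply: le_trans (wnorm_sum _ _ _ _ r0) _.
apply: (@le_trans _ _
    (16 * wnorm r K F * series (fun n => n%:R `^ (- 1 - 4^-1)) X)); last first.
  rewrite (_ : 80 = 16 * (1 + 4^-1^-1)); last by rewrite invrK; ring.
  by rewrite [leRHS]mulrAC ler_wpM2l ?mulr_ge0// series_powR_le.
rewrite /series/= mulr_sumr big_mkcond/=; apply: ler_sum => p _.
case: ifPn => pp; last by rewrite !mulr_ge0 ?powR_ge0.
have p0 := prime_gt0 pp.
have ln_le : ln p%:R <= 4 * p%:R `^ 4^-1 :> R.
  have p_gt0 : 0 < p%:R :> R by rewrite ltr0n.
  by rewrite (le_trans (ln_le_powR p_gt0 quarter_gt0))// invrK mulrC.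
rewrite wnormZ normrM (ger0_norm (ln_nat_ge0 _ _)).
apply: (@le_trans _ _ ((4 * p%:R `^ 4^-1) *
    (p%:R `^ (r - a) * (4 * p%:R `^ (r - a) * wnorm r K F)))).
  apply: ler_pM; rewrite ?mulr_ge0 ?ln_nat_ge0 ?wnorm_ge0//.
    by rewrite (le_trans (ler_piMr _ (x_le1 pp))) ?ln_nat_ge0.
  apply: le_trans (wnorm_cauchy_prod _ _ _ r0) _.
  by apply: ler_pM; rewrite ?wnorm_ge0 ?wnorm_pow_taylor ?wnorm_multiples_taylor.
rewrite [leLHS](_ : _ = 16 * wnorm r K F *
  (p%:R `^ 4^-1 * p%:R `^ (r - a) * p%:R `^ (r - a))); last by ring.
rewrite ler_wpM2l ?mulr_ge0// -!powR_natD// ler_powR_nat//; have := a_gt1; lra.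
Qed.

Lemma cvg_prime_log_sum k :
  prime_log_sum ^~ k @ \oo --> formal_deriv (dirichlet_taylor a (on_primes x)) k.
Proof.
rewrite (_ : prime_log_sum ^~ k =
    series (fun p => ln p%:R * on_primes x p * pow_taylor a p k)).
  exact: cvg_formal_deriv_dirichlet_taylor on_primes_norm_le1.
apply/funext => X; rewrite /prime_log_sum big_mkcond; apply: eq_bigr => p _.
by rewrite /on_primes; case: ifP => // _; rewrite mulr0 mul0r.
Qed.

Lemma cvg_series_ln_prime_divisors X k :
  series (fun n => ln_prime_divisors R X n * f n * pow_taylor a n k) @ \oo -->
    prime_multiples_sum X k.
Proof.
rewrite (_ : series _ = fun Y => \sum_(0 <= p < X) (on_primes (fun p => ln p%:R) p *
    series (fun n => multiple_part p f n * pow_taylor a n k) Y)).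
  rewrite /prime_multiples_sum big_mkcond/=.
  apply: (@cvg_sumr _ _ _ (fun p Y => _ * _)) => p.
  rewrite /on_primes; case: ifP => _.
    apply: cvgM; first exact: cvg_cst.
    exact: cvg_dirichlet_taylor (multiple_part_norm_le p f_le1).
  under eq_fun do rewrite mul0r; exact: cvg_cst.
apply/funext => Y; rewrite /series/=; under [RHS]eq_bigr do rewrite mulr_sumr.
rewrite exchange_big/=; apply: eq_bigr => n _.
rewrite /ln_prime_divisors big_mkcondr/= big_mkcond !mulr_suml/=.
apply: eq_bigr => p _; rewrite /on_primes /multiple_part.
by case: ifP => _; case: ifP => _; ring.
Qed.

Lemma norm_ln_sub_prime_divisors_ext_le X n :
  `|(ln n%:R - ln_prime_divisors R X n) * f n| <= if (n < X)%N then 0 else ln n%:R.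
Proof.
have [n_sqf|n_nsqf] := boolP (squarefree n); last first.
  by rewrite squarefree_ext_eq0// mulr0 normr0; case: ifP => // _; exact: ln_nat_ge0.
have n0 : (0 < n)%N by case/andP: n_sqf.
case: ifPn => nX; first by rewrite (ln_squarefree _ n_sqf nX) subrr mul0r normr0.
rewrite normrM (le_trans (ler_piMr _ (f_le1 n)))//.
rewrite ger0_norm ?subr_ge0 ?ln_prime_divisors_le// gerBl.
exact: ln_prime_divisors_ge0.
Qed.

(* [- F' = sum_p ln p F_p], where [F_p] collects the multiples of [p]: the
   contributions of the primes below [X] recover [ln n] for every squarefree
   [n < X], and at most [ln n] for the other [n]. *)
Lemma cvg_prime_multiples_sum k : prime_multiples_sum ^~ k @ \oo --> formal_deriv F k.
Proof.
pose weight n : R := ln n%:R * pow_taylor a n k.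
have weight_ge0 n : 0 <= weight n by rewrite mulr_ge0 ?ln_nat_ge0 ?pow_taylor_ge0.
have cvg_weight : cvgn (series weight) by exact: is_cvg_series_ln_pow_taylor.
have dist_le X : `|formal_deriv F k - prime_multiples_sum X k|
    <= limn (series weight) - series weight X.
  have cvg_dist : series (fun n => ln n%:R * f n * pow_taylor a n k) -
      series (fun n => ln_prime_divisors R X n * f n * pow_taylor a n k) @ \oo -->
      formal_deriv F k - prime_multiples_sum X k.
    apply: cvgB; last exact: cvg_series_ln_prime_divisors.
    exact: cvg_formal_deriv_dirichlet_taylor f_le1.
  apply: (cvgr_to_le (cvg_norm cvg_dist)); near=> Y.
  have XY : (X <= Y)%N by near: Y; exact: nbhs_infty_ge.
  have weight_le : series weight Y <= limn (series weight).
    by apply: nondecreasing_cvgn_le => //; exact: nondecreasing_series.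
  apply: (@le_trans _ _ (series weight Y - series weight X)); last by rewrite lerB.
  rewrite -[X in `|X|]/(series _ Y - series _ Y) /series/= -sumrB sub_series_geq//.
  rewrite (le_trans (ler_norm_sum _ _ _))// [leRHS](big_nat_widenl _ 0%N)//=.
  rewrite [leRHS]big_mkcond; apply: ler_sum => n _.
  rewrite -!mulrBl normrM (ger0_norm (pow_taylor_ge0 _ _ _)).
  apply: le_trans (ler_wpM2r (pow_taylor_ge0 _ _ _)
    (norm_ln_sub_prime_divisors_ext_le X n)) _.
  by rewrite /weight [(X <= n)%N]leqNgt; case: (n < X)%N; rewrite /= ?mul0r.
apply/cvgrPdist_le => e e0; near=> X; apply: le_trans (dist_le X) _.
apply: le_trans (ler_norm _) _; near: X.
by move/cvgrPdist_le : cvg_weight; apply.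
Unshelve. all: by end_near. Qed.

Lemma wnorm_log_deriv r K : 0 <= r <= 4^-1 ->
  wnorm r K (fun k => cauchy_prod (formal_deriv (dirichlet_taylor a (on_primes x))) F k
                        - formal_deriv F k) <= 80 * wnorm r K F.
Proof.
move=> r04; apply: (wnorm_lim_le (u := prime_square_sum)) => [X|k].
  exact: wnorm_prime_square_sum.
rewrite (_ : prime_square_sum ^~ k =
    fun X => cauchy_prod (prime_log_sum X) F k - prime_multiples_sum X k).
  apply: cvgB; last exact: cvg_prime_multiples_sum.
  by apply: cvg_cauchy_prodl => i; exact: cvg_prime_log_sum.
by apply/funext => X; rewrite cauchy_prod_prime_log_sum addrC addKr.
Qed.

End LogarithmicDerivative.

Section PrimeMeans.
Variables (R : realType) (x e : nat -> R) (B C C' d : R).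
Hypothesis x_le1 : primes_norm_le1 x.
Hypothesis e_bound : forall p, prime p -> -1 <= e p <= 0.
Hypothesis d01 : 0 < d < 1.
Hypothesis x_sums : forall N, `|series (on_primes (fun p => x p / p%:R)) N| <= B.
Hypothesis ext_sums : sums_le_powR C (1 - d) (squarefree_ext x).
Hypothesis centered_sums : sums_le_powR C' (1 - d) (on_primes (fun p => x p - e p)).
Implicit Types (r a : R).

Definition ext_norm_bound : R := C * abel_const d.

Definition primes_norm_bound r : R :=
  2 * B + r * (2 / euler_bound B * (80 * ext_norm_bound + ext_norm_bound / r)).

Lemma ext_norm_bound_ge0 : 0 <= ext_norm_bound.
Proof.
by rewrite mulr_ge0 ?(sums_le_powR_ge0 ext_sums) ?abel_const_ge0//; case/andP: d01.
Qed.

Lemma norm_dirichlet_taylor_on_primes_ord0_le a : 1 < a ->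
  `|dirichlet_taylor a (on_primes x) 0| <= 2 * B.
Proof.
move=> a1; have x1 := on_primes_norm_le1 x_le1.
apply: (cvgr_to_le (cvg_norm (cvg_dirichlet_taylor (k := 0) a1 x1))); near=> X.
under eq_fun do rewrite pow_taylor_ord0.
exact: norm_series_on_primes_powRN_le.
Unshelve. all: by end_near. Qed.

Lemma wnorm_dirichlet_taylor_ext_le r a K : 0 <= r <= d / 2 -> 1 < a <= 2 ->
  wnorm r K (dirichlet_taylor a (squarefree_ext x)) <= ext_norm_bound.
Proof.
move=> r_bound a12; apply: le_trans (le_wnorm _ _ r_bound) _.
exact: wnorm_dirichlet_taylor d01 a12 (squarefree_ext_norm_le1 x_le1) ext_sums.
Qed.

Lemma wnorm_cauchy_prod_prime_deriv_le r a K : 0 < r <= d / 4 -> 1 < a <= 2 ->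
  wnorm r K (cauchy_prod (formal_deriv (dirichlet_taylor a (on_primes x)))
                         (dirichlet_taylor a (squarefree_ext x)))
    <= 80 * ext_norm_bound + ext_norm_bound / r.
Proof.
move=> /andP[r0 rd] /[dup] a12 /andP[a1 _].
have [d0 d1] : 0 < d /\ d < 1 by case/andP: d01.
set P := dirichlet_taylor a (on_primes x).
set F := dirichlet_taylor a (squarefree_ext x).
rewrite (@eq_wnorm _ _ _ _ (fun k =>
  (cauchy_prod (formal_deriv P) F k - formal_deriv F k) + formal_deriv F k)); last first.
  by move=> k; rewrite subrK.
apply: le_trans (wnormD _ _ _ (ltW r0)) _; apply: lerD.
  apply: le_trans (wnorm_log_deriv a1 x_le1 K _) _; first by apply/andP; split; lra.
  by rewrite ler_wpM2l// wnorm_dirichlet_taylor_ext_le//; apply/andP; split; lra.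
apply: le_trans (wnorm_formal_deriv _ _ r0) _; rewrite ler_wpM2r ?invr_ge0 ?(ltW r0)//.
by rewrite wnorm_dirichlet_taylor_ext_le//; apply/andP; split; lra.
Qed.

Lemma wnorm_dirichlet_taylor_on_primes_le r a K : 0 < r <= d / 4 ->
  r / (d / 2) * ext_norm_bound <= euler_bound B / 2 -> 1 < a <= 2 ->
  wnorm r K (dirichlet_taylor a (on_primes x)) <= primes_norm_bound r.
Proof.
move=> /[dup] r_bound /andP[r0 rd] r_small /[dup] a12 /andP[a1 _].
have [d0 d1] : 0 < d /\ d < 1 by case/andP: d01.
pose F := dirichlet_taylor a (squarefree_ext x).
have F0_ge : euler_bound B <= `|F 0%N|.
  by apply: le_trans (ler_norm _); exact: dirichlet_taylor_ext_ge.
have F_tail : wnorm r K F - `|F 0%N| <= euler_bound B / 2.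
  apply: le_trans r_small.
  apply: (@le_trans _ _ (r / (d / 2) * wnorm (d / 2) K F)).
    by apply: wnorm_tail; lra.
  rewrite ler_wpM2l//; first by rewrite divr_ge0//; lra.
  by rewrite wnorm_dirichlet_taylor_ext_le// lexx andbT; lra.
apply: le_trans (wnorm_le_formal_deriv _ _ (ltW r0)) _.
apply: lerD; first exact: norm_dirichlet_taylor_on_primes_ord0_le.
rewrite ler_wpM2l ?(ltW r0)//.
apply: le_trans (wnorm_cauchy_prod_div _ (ltW r0) (euler_bound_gt0 B) F0_ge F_tail) _.
rewrite ler_wpM2l ?wnorm_cauchy_prod_prime_deriv_le//.
by rewrite divr_ge0// ltW// euler_bound_gt0.
Qed.

Lemma sum_prime_means_le r a X : 0 < r <= d / 4 ->
  r / (d / 2) * ext_norm_bound <= euler_bound B / 2 -> 1 < a <= 2 ->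
  \sum_(0 <= p < X) on_primes (fun p => - e p) p * p%:R `^ (r - a)
    <= C' * abel_const d + primes_norm_bound r.
Proof.
move=> r_bound r_small /[dup] a12 /andP[a1 a2].
have [d0 d1] : 0 < d /\ d < 1 by case/andP: d01.
have [r0 rd] : 0 < r /\ r <= d / 4 by case/andP: r_bound.
have e_norm : primes_norm_le1 (fun p => - e p).
  by move=> p /e_bound/andP[? ?]; rewrite normrN ler0_norm// lerNl.
have centered_le2 n : `|on_primes (fun p => x p - e p) n| <= 1 + 1.
  rewrite /on_primes; case: ifPn => [pp|_]; last by rewrite normr0 addr_ge0.
  by rewrite (le_trans (ler_normD _ _)) ?lerD ?x_le1 ?e_norm.
apply: (sum_powR_le_wnorm (c := 1)) => // [|n|K].
- by apply/andP; split; lra.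
- rewrite /on_primes; case: ifPn => [/e_bound/andP[? ?]|_]; last by rewrite lexx ler01.
  by rewrite oppr_ge0 lerNl; apply/andP.
rewrite (@eq_wnorm _ _ _ _ (fun k =>
    dirichlet_taylor a (on_primes (fun p => x p - e p)) k -
    dirichlet_taylor a (on_primes x) k)); last first.
  move=> k; apply/eqP; rewrite eq_sym subr_eq addrC; apply/eqP.
  rewrite -(dirichlet_taylorD _ a1 (on_primes_norm_le1 x_le1)
    (on_primes_norm_le1 e_norm)).
  congr dirichlet_taylor; apply/funext => n; rewrite /on_primes.
  by case: ifP; rewrite ?addr0.
apply: le_trans (wnormB _ _ _ (ltW r0)) _.
apply: lerD; last exact: wnorm_dirichlet_taylor_on_primes_le.
apply: le_trans (wnorm_dirichlet_taylor K d01 a12 centered_le2 centered_sums).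
by apply: le_wnorm; apply/andP; split; lra.
Qed.

Lemma exists_small_radius : exists r,
  0 < r <= d / 4 /\ r / (d / 2) * ext_norm_bound <= euler_bound B / 2.
Proof.
have [d0 _] : 0 < d /\ d < 1 by case/andP: d01.
have b0 := ext_norm_bound_ge0; have c0 := euler_bound_gt0 B.
have b1_gt0 : 0 < ext_norm_bound + 1 by rewrite ltr_wpDl.
pose q := euler_bound B / (2 * (ext_norm_bound + 1)).
have q0 : 0 < q by rewrite divr_gt0// mulr_gt0.
pose m := Num.min 2^-1 q.
have m0 : 0 < m by rewrite lt_min invr_gt0 q0 ltr0n.
have d2_gt0 : 0 < d / 2 by rewrite divr_gt0.
exists (m * (d / 2)); split.
  rewrite mulr_gt0//= (_ : d / 4 = 2^-1 * (d / 2)); last by field.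
  by rewrite ler_wpM2r ?(ltW d2_gt0)// ge_min lexx.
rewrite mulfK ?gt_eqF//; apply: (@le_trans _ _ (q * (ext_norm_bound + 1))).
  by apply: ler_pM; rewrite ?(ltW m0)// ?lerDl// ge_min lexx orbT.
by rewrite /q invfM mulrA divfK// gt_eqF.
Qed.

(* At [a = 1 + r / 2] the bounds of [sum_prime_means_le] reach [a - r = 1 - r / 2],
   because the radius [r] does not depend on [a]. *)
Lemma prime_means_series_cvg : exists alpha : R, 0 < alpha < 4^-1 /\
  prime_series_cvg (fun p => e p / p%:R `^ (1 - alpha)).
Proof.
have [r [r_bound r_small]] := exists_small_radius.
have [[r0 rd] [d0 d1]] : (0 < r /\ r <= d / 4) /\ (0 < d /\ d < 1).
  by case/andP: r_bound; case/andP: d01.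
exists (r / 2); split; first by apply/andP; split; lra.
have a12 : 1 < 1 + r / 2 <= 2 by apply/andP; split; lra.
pose u p := on_primes (fun p => - e p) p * p%:R `^ (r - (1 + r / 2)).
rewrite /prime_series_cvg (_ : (fun p => _) = - u).
  rewrite is_cvg_seriesN; apply: nondecreasing_is_cvgn.
    apply: nondecreasing_series => p _ _; rewrite /u /on_primes.
    case: ifPn => [/e_bound/andP[_ e0]|_]; last by rewrite mul0r.
    by rewrite mulr_ge0 ?powR_ge0 ?oppr_ge0.
  exists (C' * abel_const d + primes_norm_bound r) => _ [X _ <-].
  exact: sum_prime_means_le.
apply/funext => p; rewrite -[RHS]/(- u p) /u /on_primes.
case: ifP => _; last by rewrite mul0r oppr0.
rewrite mulNr opprK -powRN; congr (_ * _ `^ _); lra.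
Qed.

End PrimeMeans.

Section BoundedRandomVariables.
Context (d : measure_display) (T : measurableType d) (R : realType) (P : probability T R).
Implicit Types (X Y : T -> R) (A B : set T) (M r : R).

Lemma Lfun_bounded X M r : measurable_fun setT X -> 0 <= r ->
  (forall w, `|X w| <= M) -> X \in Lfun P r%:E.
Proof.
move=> mX r0 XM; rewrite inE/=; apply/andP; split; rewrite inE//=.
rewrite /finite_norm unlock poweR_lty//.
apply: (@le_lt_trans _ _ (\int[P]_x (M `^ r)%:E)%E); last first.
  by rewrite integral_cst//= probability_setT mule1 ltry.
apply: ge0_le_integral => //.
- by move=> x _; rewrite lee_fin powR_ge0.
- apply/measurable_EFinP; apply: (measurableT_comp (measurable_powR _)) => //.
  exact: measurableT_comp.
- move=> x _; rewrite lee_fin ge0_ler_powR// nnegrE.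
  exact: le_trans (XM x).
Qed.

Lemma Lfun_indic A r : measurable A -> 0 <= r -> (\1_A : T -> R) \in Lfun P r%:E.
Proof.
move=> mA r0; apply: (@Lfun_bounded _ 1) => // w.
by rewrite indicE normr_nat lern1 leq_b1.
Qed.

Lemma norm_expectation_le X M : measurable_fun setT X ->
  (forall w, `|X w| <= M) -> `|fine ('E_P[X])%E| <= M.
Proof.
move=> mX XM; have X1 := Lfun_bounded mX ler01 XM.
rewrite -lee_fin -abse_EFin fineK ?expectation_fin_num//.
rewrite unlock (le_trans (le_abse_integral _ _ _))//; first exact/measurable_EFinP.
apply: (@le_trans _ _ (\int[P]_x M%:E)%E); last first.
  by rewrite integral_cst//= probability_setT mule1.
apply: ge0_le_integral => //.
- by apply/measurable_EFinP; exact: measurableT_comp.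
- by move=> x _; rewrite lee_fin XM.
Qed.

Lemma variance_le_sqr X M : measurable_fun setT X ->
  (forall w, `|X w| <= M) -> (variance P X <= (M ^+ 2)%:E)%E.
Proof.
move=> mX XM; have two_ge0 : 0 <= 2 :> R by [].
have X1 := Lfun_bounded mX ler01 XM; have X2 := Lfun_bounded mX two_ge0 XM.
rewrite varianceE// leeBlDr ?fin_numX ?expectation_fin_num//.
rewrite (@le_trans _ _ (M ^+ 2)%:E)//; last by rewrite leeDl// sqre_ge0.
rewrite -[leRHS](expectation_cst P).
rewrite (_ : X ^+ 2 = fun w => X w ^+ 2); last by apply/funext => w; rewrite expr2.
apply: expectation_le => //.
- exact: measurable_funX.
- by move=> w; rewrite /= sqr_ge0.
- by move=> w; rewrite /= sqr_ge0.
- apply: aeW => w /=; rewrite -real_normK ?num_real// lerXn2r ?nnegrE//.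
  exact: le_trans (XM w).
Qed.

Lemma variance_sum_uncorrelated (X : nat -> T -> R) N :
  (forall n, X n \in Lfun P 2%:E) ->
  (forall m n, m != n -> covariance P (X m) (X n) = 0%E) ->
  (variance P (\sum_(0 <= k < N) X k)%R = \sum_(0 <= k < N) variance P (X k))%E.
Proof.
move=> X2 X_uncorr.
have sum2 m : \sum_(0 <= k < m) X k \in Lfun P 2%:E by rewrite rpred_sum ?lee1n.
have cov_sum m n : (m <= n)%N -> (covariance P (\sum_(0 <= k < m) X k)%R (X n) = 0)%E.
  elim: m => [_|m IH mn]; first by rewrite big_geq//; exact: covariance_cst_l.
  rewrite big_nat_recr//= covarianceDl// IH ?(ltnW mn)// add0e X_uncorr//.
  by rewrite ltn_eqF.
elim: N => [|N IH]; first by rewrite !big_geq//; exact: variance_cst.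
by rewrite !big_nat_recr//= varianceD// cov_sum// mule0 adde0 IH.
Qed.

Lemma covariance_indic A B : measurable A -> measurable B ->
  covariance P \1_A \1_B = (P (A `&` B) - P A * P B)%E.
Proof.
move=> mA mB.
have indic1 C : measurable C -> (\1_C : T -> R) \in Lfun P 1.
  by move=> mC; exact: Lfun_indic.
have indicM : ((\1_A : T -> R) * \1_B)%R = \1_(A `&` B) by rewrite indicI.
have mAB := measurableI _ _ mA mB.
by rewrite covarianceE ?indicM ?indic1// !expectation_indic.
Qed.

(* A sign is an affine function of the indicator of the event that it is [1]. *)
Lemma covariance_sign X Y : measurable_fun setT X -> measurable_fun setT Y ->
  (forall w, X w = -1 \/ X w = 1) -> (forall w, Y w = -1 \/ Y w = 1) ->
  (P (X @^-1` [set 1%R] `&` Y @^-1` [set 1%R]) =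
     P (X @^-1` [set 1%R]) * P (Y @^-1` [set 1%R]))%E ->
  covariance P X Y = 0%E.
Proof.
move=> mX mY Xsign Ysign PXY.
have signE (Z : T -> R) : (forall w, Z w = -1 \/ Z w = 1) ->
    Z = ((2 \o* \1_(Z @^-1` [set 1])) \- cst 1)%R.
  move=> Zsign; apply/funext => w; rewrite /= indicE.
  have [Zw|Zw] := Zsign w; last by rewrite mem_set//= Zw; ring.
  rewrite memNset//= Zw; first by ring.
  by move=> h; have := ltrN10 R; rewrite h ltNge ler01.
have preimage_measurable (Z : T -> R) :
    measurable_fun setT Z -> measurable (Z @^-1` [set 1]).
  by move=> mZ; rewrite -[_ @^-1` _]setTI; exact: mZ.
have indic1 C : measurable C -> (\1_C : T -> R) \in Lfun P 1.
  by move=> mC; exact: Lfun_indic.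
have indic2 C : measurable C -> (\1_C : T -> R) \in Lfun P 2%:E.
  by move=> mC; exact: Lfun_indic.
have scale2 C : measurable C -> (2 \o* \1_C : T -> R) \in Lfun P 2%:E.
  by move=> mC; apply: Lfun_scale; rewrite ?ler1n ?indic2.
have cst2 : (cst 1 : T -> R) \in Lfun P 2%:E by exact: Lfun_cst.
have cov_affine C Z : measurable C -> Z \in Lfun P 2%:E ->
    covariance P ((2 \o* \1_C) \- cst 1)%R Z = (2%:E * covariance P \1_C Z)%E.
  move=> mC Z2; rewrite covarianceBl ?scale2// covariance_cst_l sube0.
  rewrite covarianceZl ?indic1//; last by apply: Lfun2_mul_Lfun1; rewrite ?indic2.
  by apply: Lfun_subset12 => //; rewrite fin_num_measure.
have Y2 : Y \in Lfun P 2%:E.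
  apply: (@Lfun_bounded _ 1) => // w.
  by case: (Ysign w) => ->; rewrite ?normrN normr1.
have [mA mB] := (preimage_measurable X mX, preimage_measurable Y mY).
rewrite (signE X Xsign) cov_affine// covarianceC (signE Y Ysign) cov_affine ?indic2//.
by rewrite covarianceC covariance_indic// PXY subee ?mule0// fin_numM ?fin_num_measure.
Qed.

End BoundedRandomVariables.

Section AlmostSureBounds.
Context (d : measure_display) (T : measurableType d) (R : realType)
  (mu : {measure set T -> \bar R}).

Lemma ae_bounded_of_integral_series (Y : nat -> T -> R) (b : nat -> R) :
  (forall k w, 0 <= Y k w) -> (forall k, measurable_fun setT (Y k)) ->
  (forall k, \int[mu]_w (Y k w)%:E <= (b k)%:E)%E -> cvgn (series b) ->
  {ae mu, forall w, exists M, forall k, Y k w <= M}.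
Proof.
move=> Y0 mY Yb cvg_b.
have EY0 k w : (0 <= (Y k w)%:E)%E by rewrite lee_fin.
have mEY k : measurable_fun setT (fun w => (Y k w)%:E) by exact/measurable_EFinP.
have sum_integrable : mu.-integrable setT (fun w => \sum_(k <oo) (Y k w)%:E)%E.
  apply/integrableP; split.
    exact: ge0_emeasurable_sum.
  under eq_integral do rewrite gee0_abs ?nneseries_ge0//.
  rewrite integral_nneseries//.
  apply: (@le_lt_trans _ _ (limn (series b))%:E); last exact: ltry.
  apply: lime_le; first by apply: is_cvg_nneseries => k _ _; exact: integral_ge0.
  near=> n; apply: (@le_trans _ _ (\sum_(0 <= k < n) (b k)%:E)%E).
    exact: lee_sum.
  rewrite sumEFin lee_fin; apply: nondecreasing_cvgn_le => //.
  apply: nondecreasing_series => k _ _; rewrite -lee_fin.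
  by apply: le_trans (Yb k); exact: integral_ge0.
have := integrable_ae measurableT sum_integrable; apply: filterS => w /(_ I) sum_fin.
exists (fine (\sum_(k <oo) (Y k w)%:E)%E) => k.
rewrite -lee_fin fineK//; apply: le_trans (nneseries_lim_ge k.+1 _) => //.
by rewrite big_nat_recr//= leeDr// sume_ge0.
Unshelve. all: by end_near. Qed.

End AlmostSureBounds.

Section UncorrelatedSums.
Variable R : realType.

Lemma exists_fourth_root n : (0 < n)%N ->
  exists k, [/\ (0 < k)%N, (k ^ 4 <= n)%N & (n < k.+1 ^ 4)%N].
Proof.
move=> n0; have ex : exists k, (k ^ 4 <= n)%N by exists 0%N.
have bounded k : (k ^ 4 <= n)%N -> (k <= n)%N.
  by case: k => // k; apply: leq_trans; rewrite -{1}(expn1 k.+1) leq_pexp2l.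
case: (ex_maxnP ex bounded) => k kn kmax; exists k; split=> //.
  by apply: kmax; rewrite exp1n.
by rewrite ltnNge; apply/negP => /kmax; rewrite ltnn.
Qed.

(* Consecutive fourth powers differ by at most [15 k ^ 3], so a sequence with bounded
   increments is controlled by its values there. *)
Lemma norm_le_powR_of_fourth_powers (U : nat -> R) (M L : R) :
  (forall n, `|U n.+1 - U n| <= L) ->
  (forall k, (0 < k)%N -> `|U (k ^ 4)%N| <= M * k%:R ^+ 3) ->
  forall n, `|U n.+1| <= (M + 15 * L) * n.+1%:R `^ (3 / 4).
Proof.
move=> U_incr U_pow n.
have L0 : 0 <= L by exact: le_trans (U_incr 0%N).
have M0 : 0 <= M by have := U_pow 1%N isT; rewrite expr1n mulr1; exact: le_trans.
have [k [k0 kn nk]] := exists_fourth_root (ltn0Sn n).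
have gap : (n.+1 - k ^ 4 <= 15 * k ^ 3)%N.
  have succE : (k.+1 ^ 4 = k ^ 4 + (4 * k ^ 3 + 6 * k ^ 2 + 4 * k + 1))%N.
    by rewrite -addn1 !expnS !expn0; ring.
  have k2 : (k ^ 2 <= k ^ 3)%N by rewrite leq_pexp2l.
  have k1 : (k <= k ^ 3)%N by rewrite -{1}(expn1 k) leq_pexp2l.
  have k3 : (0 < k ^ 3)%N by rewrite expn_gt0 k0.
  by move: nk k2 k1 k3; rewrite succE; move: (k ^ 4)%N (k ^ 2)%N (k ^ 3)%N => *; lia.
have U_gap : `|U n.+1 - U (k ^ 4)%N| <= 15 * L * k%:R ^+ 3.
  rewrite -(telescope_sumr _ kn) (le_trans (ler_norm_sum _ _ _))//.
  apply: (@le_trans _ _ (\sum_(k ^ 4 <= j < n.+1) L)); first exact: ler_sum.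
  rewrite big_const_nat iter_addr_0 -[leLHS]mulr_natr -mulrA [leRHS]mulrCA ler_wpM2l//.
  by rewrite -natrX -natrM ler_nat.
have k3_le : k%:R ^+ 3 <= n.+1%:R `^ (3 / 4) :> R.
  have -> : k%:R ^+ 3 = (k ^ 4)%:R `^ (3 / 4) :> R.
    by rewrite natrX -!powR_mulrn// -powRrM; congr (_ `^ _); field.
  by rewrite ge0_ler_powR ?nnegrE ?ler_nat//; lra.
rewrite -(subrK (U (k ^ 4)%N) (U n.+1)) (le_trans (ler_normD _ _))//.
rewrite (le_trans (lerD U_gap (U_pow k k0)))// -mulrDl addrC ler_wpM2l//.
by rewrite addr_ge0// mulr_ge0.
Qed.

Context (d : measure_display) (T : measurableType d) (P : probability T R).
Variables (X : nat -> T -> R) (M : R).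
Hypothesis mX : forall n, measurable_fun setT (X n).
Hypothesis X_bound : forall n w, `|X n w| <= M.
Hypothesis X_uncorr : forall m n, m != n -> covariance P (X m) (X n) = 0%E.

Definition centered_sum N w : R := \sum_(0 <= k < N) (X k w - fine ('E_P[X k])%E).

Lemma measurable_centered_sum N : measurable_fun setT (centered_sum N).
Proof. by apply: measurable_sum => k; exact: measurable_funB. Qed.

Lemma integral_centered_sum_sqr_le N :
  (\int[P]_w (centered_sum N w ^+ 2)%:E <= (N%:R * M ^+ 2)%:E)%E.
Proof.
have X1 n : X n \in Lfun P 1 by exact: Lfun_bounded (mX n) ler01 (X_bound n).
have X2 n : X n \in Lfun P 2%:E by apply: Lfun_bounded (mX n) _ (X_bound n).
have sum_mean : ('E_P[(\sum_(0 <= k < N) X k)%R] =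
    (\sum_(0 <= k < N) fine ('E_P[X k])%E)%R%:E)%E.
  elim: N => [|N IH]; first by rewrite !big_geq//; exact: expectation_cst.
  rewrite !big_nat_recr//= expectationD ?rpred_sum// IH EFinD; congr (_ + _)%E.
  by rewrite fineK// expectation_fin_num.
apply: (@le_trans _ _ (variance P (\sum_(0 <= k < N) X k))); last first.
  rewrite variance_sum_uncorrelated// mulr_natl -[in leRHS](subn0 N) -sumr_const_nat.
  by rewrite -sumEFin; apply: lee_sum => k _; exact: variance_le_sqr.
have centeredE w : centered_sum N w =
    (\sum_(0 <= k < N) X k) w - fine ('E_P[(\sum_(0 <= k < N) X k)%R])%E.
  by rewrite sum_mean /centered_sum sumrB fct_sumE.
move: (\sum_(0 <= k < N) X k) centeredE => S centeredE.
under eq_integral do rewrite centeredE expr2.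
by rewrite /variance 3!unlock.
Qed.

(* Chebyshev's inequality and Borel-Cantelli along the fourth powers. *)
Lemma ae_centered_sum_le : {ae P, forall w, exists C,
  forall n, `|centered_sum n.+1 w| <= C * n.+1%:R `^ (3 / 4)}.
Proof.
pose Y k w : R := centered_sum (k ^ 4) w ^+ 2 * k%:R `^ (- 6).
have Y_integral k : (\int[P]_w (Y k w)%:E <= (M ^+ 2 * k%:R `^ (- 1 - 1))%:E)%E.
  under eq_integral do rewrite EFinM.
  rewrite ge0_integralZr//; last first.
  - by move=> *; rewrite lee_fin sqr_ge0.
  - by apply/measurable_EFinP/measurable_funX; exact: measurable_centered_sum.
  apply: (@le_trans _ _ (((k ^ 4)%:R * M ^+ 2)%:E * (k%:R `^ (- 6))%:E)%E).
    by rewrite lee_wpmul2r ?lee_fin ?powR_ge0// integral_centered_sum_sqr_le.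
  rewrite -EFinM lee_fin mulrAC mulrC ler_wpM2l ?sqr_ge0//; case: k => [|k].
    by rewrite powR0 ?mulr0 ?powR_ge0// oppr_eq0.
  by rewrite natrX -powR_mulrn// -powR_natD// ler_powR_nat//; lra.
have cvg_bound : cvgn (series (fun k => M ^+ 2 * k%:R `^ (- 1 - 1) : R)).
  by apply: is_cvg_seriesZ; exact: is_cvg_series_powR.
apply: filterS (ae_bounded_of_integral_series _ _ Y_integral cvg_bound) => [w [C YC]||].
- exists (Num.sqrt C + 15 * (M + M)).
  apply: (norm_le_powR_of_fourth_powers (U := centered_sum ^~ w)) => [n|k k0].
    rewrite /centered_sum big_nat_recr//= addrAC subrr add0r.
    rewrite (le_trans (ler_normB _ _))// lerD ?X_bound//.
    exact: norm_expectation_le (mX n) (X_bound n).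
  have := YC k; rewrite /Y powRN -/(_ / _) ler_pdivrMr ?powR_gt0 ?ltr0n//.
  rewrite powR_mulrn// => sqr_le.
  have C0 : 0 <= C by apply: le_trans (YC k); rewrite mulr_ge0 ?sqr_ge0 ?powR_ge0.
  rewrite -sqrtr_sqr (le_trans (ler_wsqrtr sqr_le))// sqrtrM//.
  by rewrite (_ : _ ^+ 6 = (k%:R ^+ 3) ^+ 2) ?sqrtr_sqr ?ger0_norm ?exprn_ge0// -exprM.
- by move=> k w; rewrite mulr_ge0 ?sqr_ge0 ?powR_ge0.
- move=> k; apply: measurable_funM => //.
  by apply: measurable_funX; exact: measurable_centered_sum.
Qed.

End UncorrelatedSums.

Section RandomMultiplicative.
Context (d : measure_display) (T : measurableType d) (R : realType)
  (P : probability T R) (f : nat -> {RV P >-> R}).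
Hypothesis f_mult : random_multiplicative f.
Implicit Types (w : T) (p q n : nat).

Definition prime_mean p : R := fine ('E_P[f p])%E.

Lemma rm_primes_norm_le1 w : primes_norm_le1 (fun p => f p w).
Proof. by move=> p /(rm_prime f_mult w)[] ->; rewrite ?normrN normr1. Qed.

Lemma prime_mean_bound p : biased f -> prime p -> -1 <= prime_mean p <= 0.
Proof.
move=> f_biased pp; apply/andP; split; last by rewrite fine_le0// ltW// f_biased.
have := norm_expectation_le P (measurable_funPT (f p)) (fun w => rm_primes_norm_le1 w pp).
by rewrite ler_norml => /andP[].
Qed.

Lemma rm_squarefree_ext w n : (0 < n)%N -> f n w = squarefree_ext (fun p => f p w) n.
Proof.
case: n => [//|[_|n _]]; first by rewrite (rm_1 f_mult) squarefree_ext1.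
rewrite (rm_mult f_mult)// /moebius /squarefree_ext; congr (_ * _).
by case: ifP => _; rewrite ?normr0// normrX normrN normr1 expr1n.
Qed.

Lemma partial_sum_natE w n :
  partial_sum f w n%:R = series (squarefree_ext (fun p => f p w)) n.+1.
Proof.
rewrite /partial_sum natrK /series/= [RHS]big_nat_recl//= squarefree_ext0 add0r big_add1.
by apply: eq_bigr => k _; exact: rm_squarefree_ext.
Qed.

Lemma partial_sum_littleo_sums_le_powR w s : 0 < s ->
  partial_sum f w =o_+oo (fun x : R => x `^ s) ->
  exists C, sums_le_powR C s (squarefree_ext (fun p => f p w)).
Proof.
move=> s0 /eqoP/(_ 1 ltr01)[M [_ small_after_M]].
have ext1 := squarefree_ext_norm_le1 (rm_primes_norm_le1 w).
exists (1 + `|M|) => -[|n].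
  by rewrite /series/= big_nat1 squarefree_ext0 normr0 mulr_ge0 ?powR_ge0.
have pow_ge1 : 1 <= n.+1%:R `^ s :> R.
  by rewrite -[leLHS](powRr0 n.+1%:R) ler_powR_nat// ltW.
have [Mn|nM] := ltP M n.+1%:R.
  have := small_after_M _ Mn; rewrite mul1r partial_sum_natE (ger0_norm (powR_ge0 _ _)).
  by move=> /le_trans -> //; rewrite ler_peMl ?powR_ge0// lerDl.
apply: (@le_trans _ _ n.+1%:R).
  rewrite /series/= big_nat_recl// squarefree_ext0 add0r.
  rewrite (le_trans (ler_norm_sum _ _ _))//.
  rewrite (le_trans (ler_sum _ (fun i _ => ext1 i.+1)))//.
  by rewrite big_const_nat subn0 iter_addr_0.
rewrite (le_trans nM)// (le_trans (ler_norm M))//.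
by rewrite (@le_trans _ _ (1 + `|M|)) ?lerDr// ler_peMr// addr_ge0.
Qed.

Lemma rm_prime_uncorrelated p q : prime p -> prime q -> p != q ->
  covariance P (f p) (f q) = 0%E.
Proof.
move=> pp pq pNq; apply: covariance_sign => //.
- by move=> w; exact: rm_prime.
- by move=> w; exact: rm_prime.
have := rm_indep f_mult (J := (p |` [fset q])%fset) (B := fun=> [set 1]).
rewrite big_fsetU1 ?inE// big_seq_fset1 => <- //; last first.
  by move=> i /=; rewrite !inE => /orP[]/eqP ->.
congr (P _); apply/seteqP; split => w /=.
  by move=> [fp fq] i /=; rewrite !inE => /orP[]/eqP ->.
by move=> f1; split; apply: f1; rewrite /= !inE eqxx ?orbT.
Qed.

Lemma ae_centered_primes_sums_le_powR : {ae P, forall w, exists C,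
  sums_le_powR C (3 / 4) (on_primes (fun p => f p w - prime_mean p))}.
Proof.
pose X p : T -> R := if prime p then f p else cst 0.
have mX n : measurable_fun setT (X n) by rewrite /X; case: ifP.
have X_le1 n w : `|X n w| <= 1.
  by rewrite /X; case: ifPn => [/(rm_primes_norm_le1 w)|_] //=; rewrite normr0.
have X_uncorr m n : m != n -> covariance P (X m) (X n) = 0%E.
  move=> mNn; rewrite /X; case: ifPn => pm; last exact: covariance_cst_l.
  by case: ifPn => pn; [exact: rm_prime_uncorrelated|exact: covariance_cst_r].
apply: filterS (ae_centered_sum_le mX X_le1 X_uncorr) => w [C centered_le].
have C0 : 0 <= C.
  by have := centered_le 0%N; rewrite powR1 mulr1; apply: le_trans.
exists (2 * C) => -[|n].
  by rewrite /series/= big_nat1 normr0 !mulr_ge0 ?powR_ge0.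
have -> : series (on_primes (fun p => f p w - prime_mean p)) n.+2 =
    centered_sum P X n.+2 w.
  apply: eq_bigr => k _; rewrite /on_primes /prime_mean /X; case: ifP => // _.
  by rewrite expectation_cst/= subrr.
apply: le_trans (centered_le n.+1) _; rewrite (mulrC 2) -mulrA ler_wpM2l//.
by apply: powR_succ_le2 => //; apply/andP; split; lra.
Qed.

Lemma ae_centered_prime_series_cvg s : 3 / 4 < s ->
  {ae P, forall w, prime_series_cvg (fun p => (f p w - prime_mean p) / p%:R `^ s)}.
Proof.
move=> s34; apply: filterS ae_centered_primes_sums_le_powR => w [C centered_le].
rewrite /prime_series_cvg (_ : (fun n => _) =
    fun n => on_primes (fun p => f p w - prime_mean p) n * n%:R `^ (- s)).
  by apply: is_cvg_series_sums_le_powR centered_le; apply/andP; split; lra.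
apply/funext => n; rewrite /on_primes powRN.
by case: ifP => // _; rewrite mul0r.
Qed.

(* The means are deterministic, so one sample point at which all the almost sure
   properties hold decides the convergence of their series. *)
Lemma rm_prime_means_series_cvg : weakly_biased f ->
  {ae P, forall w, exists delta : R,
    [/\ 0 < delta, delta < 1 / 2 &
        partial_sum f w =o_+oo (fun x : R => x `^ (1 - delta))]} ->
  exists alpha : R, 0 < alpha < 4^-1 /\
    prime_series_cvg (fun p => prime_mean p / p%:R `^ (1 - alpha)).
Proof.
move=> [f_biased f_cvg] f_small.
have ae_proper : ProperFilter (almost_everywhere P).
  apply: ae_properfilter_algebraOfSetsType.
  by have : (0 < P setT)%E by rewrite probability_setT lte01.
have [w [[[delta [delta0 delta2 f_littleo]] f_cvg_w] [C' centered_le]]] :=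
  filter_ex (filterI (filterI f_small f_cvg) ae_centered_primes_sums_le_powR).
have [C ext_le] : exists C, sums_le_powR C (1 - delta) (squarefree_ext (fun p => f p w)).
  by apply: partial_sum_littleo_sums_le_powR => //; lra.
have [B sums_le] := cvg_has_ub f_cvg_w.
pose t := Num.min delta 4^-1.
have t0 : 0 < t by rewrite lt_min delta0 invr_gt0/=.
have t4 : t <= 4^-1 by rewrite ge_min lexx orbT.
have t_delta : t <= delta by rewrite ge_min lexx.
apply: (@prime_means_series_cvg _ (fun p => f p w) _ B C C' t).
- exact: rm_primes_norm_le1.
- by move=> p; exact: prime_mean_bound.
- by apply/andP; split; lra.
- by move=> N; apply: sums_le; exists N.
- by apply: sums_le_powR_le ext_le; lra.
- by apply: sums_le_powR_le centered_le; lra.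
Qed.

End RandomMultiplicative.

Theorem theorem1p3 (d : measure_display) (T : measurableType d)
    (R : realType) (P : probability T R) (f : nat -> {RV P >-> R})
    (f_mult : random_multiplicative f) (f_wb : weakly_biased f)
    (f_small : {ae P, forall w, exists delta : R,
       [/\ 0 < delta, delta < 1 / 2 &
           partial_sum f w =o_+oo (fun x : R => x `^ (1 - delta))]}) :
  exists alpha : R,
    [/\ 0 < alpha, alpha < 1 / 2 &
        {ae P, forall w,
           prime_series_cvg (fun p : nat => f p w / p%:R `^ (1 - alpha))}].
Proof.
have [alpha [/andP[alpha0 alpha4] means_cvg]] :=
  rm_prime_means_series_cvg f_mult f_wb f_small.
exists alpha; split => //; first lra.
have s34 : 3 / 4 < 1 - alpha by lra.
apply: filterS (ae_centered_prime_series_cvg f_mult s34) => w centered_cvg.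
rewrite /prime_series_cvg (_ : (fun n => _) =
  on_primes (fun p => (f p w - prime_mean f p) / p%:R `^ (1 - alpha)) +
  on_primes (fun p => prime_mean f p / p%:R `^ (1 - alpha))).
  exact: is_cvg_seriesD.
apply/funext => n; rewrite -[RHS]/(on_primes _ n + on_primes _ n) /on_primes.
by case: ifP => _; rewrite ?addr0// -mulrDl subrK.
Qed.
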